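(* Let $K$ be an imaginary quadratic field with discriminant $D_K$, let $\ell$ be a prime, and let $\mathcal O_0$ be an order of conductor $c$ in $K$ with $\ell\nmid c$. Then $\kappa_0=1$ and $\pi'_0:\kappa_1\to\kappa_0$ is the trivial map. For $d\geq1$, the following hold, where ''can'' denotes the canonical surjection $\mathbf Z/\ell^{m+1}\mathbf Z\to\mathbf Z/\ell^m\mathbf Z$, and the statement about $\pi'_d$ means that under suitable isomorphisms of $\kappa_{d+1}$ and $\kappa_d$ with the stated groups, $\pi'_d$ becomes the stated map: (a) if $\ell\geq3$ and $\ell$ is split or inert in $\mathcal O_K$: $\kappa_d\cong\mathbf Z/\ell^{d-1}\mathbf Z$ and $\pi'_d$ is can; (b) if $\ell$ is ramified in $\mathcal O_K$ and either ($\ell=2$ and $D_K\equiv 8\bmod 16$) or ($\ell=3$ and $D_K\equiv 3\bmod 9$) or $\ell\ge5$: $\kappa_d\cong\mathbf Z/\ell^{d}\mathbf Z$ and $\pi'_d$ is can; (c) if $\ell$ is ramified in $\mathcal O_K$ and either ($\ell=2$ and $D_K\equiv12\bmod16$) or ($\ell=3$ and $D_K\equiv 6\bmod 9$): $\kappa_d\cong\mathbf Z/\ell^{d-1}\mathbf Z\times\mathbf Z/\ell\mathbf Z$ and $\pi'_d$ is $\mathrm{can}\times\mathrm{id}$; (d) if $\ell=2$ is split or inert in $\mathcal O_K$ and $d\geq2$: $\kappa_d\cong\mathbf Z/2^{d-2}\mathbf Z\times\mathbf Z/2\mathbf Z$ and $\pi'_d$ is $\mathrm{can}\times\mathrm{id}$;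 and if $\ell=2$ is split or inert then $\kappa_1\cong 0$.
   Context: For $d\geq0$, $\mathcal O_d$ denotes the order of conductor $c\ell^d$ in $K$, $\operatorname{Cl}(\mathcal O_d)$ its class group (proper fractional ideals modulo principal ideals), and $S_d=\operatorname{Cl}(\mathcal O_d)[\ell^\infty]$ its Sylow $\ell$-subgroup. For $d'\geq d$ there is a natural surjection $\operatorname{Cl}(\mathcal O_{d'})\to\operatorname{Cl}(\mathcal O_d)$, $[\mathfrak p\cap\mathcal O_{d'}]\mapsto[\mathfrak p\cap\mathcal O_d]$ for prime ideals $\mathfrak p$ of $\mathcal O_K$. $\kappa_d$ is the kernel of the induced surjection $S_d\to S_0$, $\pi_d:S_{d+1}\to S_d$ is the induced surjection, and $\pi'_d:\kappa_{d+1}\to\kappa_d$ is the restriction of $\pi_d$.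
   Formalization: Part (c) excludes c = 1 with D_K = -4 (ℓ = 2) or D_K = -3 (ℓ = 3), where it is false for every d ≥ 1 because of the extra units: e.g. it would give κ_1 ≅ Z/2 in Cl(Z[2i]), but h(-16) = 1; likewise κ_1 ≅ Z/3, but h(-27) = 1. *)

(* Defs.v *)
From HB Require Import structures.
From mathcomp Require Import all_boot all_order all_algebra all_field.
From mathcomp Require Import boolp classical_sets.
From mathcomp Require Import ring.

Set Implicit Arguments.
Unset Strict Implicit.
Unset Printing Implicit Defensive.

Import Order.TTheory GRing.Theory Num.Theory.
Local Open Scope classical_set_scope.
Local Open Scope ring_scope.

Section Field.
Variable K : fieldExtType rat.
Implicit Types (A B C O I J P : set K) (x y z : K) (f : nat) (D : int).

Definition quadratic : Prop := \dim {:K}%VS = 2%N.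

Definition imaginary : Prop :=
  ~ exists s : {rmorphism K -> algC}, forall x, s x \is Num.real.

Definition ringInt : set K := [set x | integralOver (intr : int -> K) x].

(* Z + f O_K, which is the order of conductor f when f > 0 *)
Definition qorder f : set K :=
  [set x | exists (n : int) y, ringInt y /\ x = n%:~R + f%:R * y].

Definition trace x : rat :=
  \tr (passmx.mxof (vbasis {:K}) (vbasis {:K}) (amulr x)).

(* D is the discriminant of the trace form on a Z-basis w of the maximal order *)
Definition is_discriminant D : Prop :=
  exists w : 2.-tuple K,
    [/\ basis_of {:K}%VS w,
        ringInt = [set x | exists a : 'I_2 -> int,
                     x = \sum_i (a i)%:~R * tnth w i]
      & D%:~R = \det (\matrix_(i < 2, j < 2) trace (tnth w i * tnth w j))].

Definition idmul A B : set K :=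
  [set x | exists2 s : seq (K * K), (forall u, u \in s -> A u.1 /\ B u.2)
           & x = \sum_(u <- s) u.1 * u.2].

Definition idscale x A : set K := [set x * y | y in A].

Record submodule O I : Prop := Submodule {
  subm0 : I 0;
  submB : forall x y, I x -> I y -> I (x - y);
  submM : forall a x, O a -> I x -> I (a * x) }.

Record prime_ideal P : Prop := PrimeIdeal {
  prime_submodule : submodule ringInt P;
  prime_sub : P `<=` ringInt;
  prime_proper : ~ P 1;
  prime_mul : forall x y, ringInt x -> ringInt y -> P (x * y) -> P x \/ P y }.

Definition split_in (p : nat) : Prop := exists P Q : set K,
  [/\ prime_ideal P, prime_ideal Q, P <> Q
    & idscale p%:R ringInt = idmul P Q].
Definition inert_in (p : nat) : Prop := prime_ideal (idscale p%:R ringInt).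
Definition ramified_in (p : nat) : Prop := exists2 P : set K,
  prime_ideal P & idscale p%:R ringInt = idmul P P.

Record fractional O I : Prop := Fractional {
  frac_submodule : submodule O I;
  frac_neq0 : exists2 x, I x & x != 0;
  frac_den : exists2 d, d != 0 & forall x, I x -> O (d * x) }.

(* proper: the multiplier ring of I is O, and not a larger order *)
Definition proper O I : Prop :=
  fractional O I /\ [set x | forall y, I y -> I (x * y)] = O.

Lemma idmul_sum A (s : seq (K * K)) :
  A 0 -> (forall x y, A x -> A y -> A (x + y)) ->
  (forall u, u \in s -> A (u.1 * u.2)) -> A (\sum_(u <- s) u.1 * u.2).
Proof.
move=> A0 AD; elim: s => [|u s IH] h; first by rewrite big_nil.
rewrite big_cons; apply: AD; first by apply: h; rewrite mem_head.
by apply: IH => v vs; apply: h; rewrite inE vs orbT.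
Qed.

Lemma submN O I x : submodule O I -> I x -> I (- x).
Proof. by move=> h Ix; rewrite -sub0r; apply: (submB h) => //; apply: subm0 h. Qed.

Lemma submD O I x y : submodule O I -> I x -> I y -> I (x + y).
Proof.
by move=> h Ix Iy; rewrite -[y]opprK; apply: (submB h) => //; apply: submN h _.
Qed.

Lemma submZ O I (n : int) x : submodule O I -> I x -> I (n%:~R * x).
Proof.
move=> h Ix; have hn (k : nat) : I (k%:R * x).
  elim: k => [|k IH]; first by rewrite mul0r; apply: subm0 h.
  by rewrite -natr1 mulrDl mul1r; apply: (submD h).
case: n => n; first exact: hn.
by rewrite NegzE mulrNz mulNr; apply: (submN h); apply: hn.
Qed.

Lemma idmul_min A B C :
  C 0 -> (forall x y, C x -> C y -> C (x + y)) ->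
  (forall x y, A x -> B y -> C (x * y)) -> idmul A B `<=` C.
Proof.
move=> C0 CD h x [s hs ->]; apply: idmul_sum => // u us.
by have [? ?] := hs u us; apply: h.
Qed.

Lemma idmul_in A B x y : A x -> B y -> idmul A B (x * y).
Proof.
move=> Ax By; exists [:: (x, y)]; last by rewrite big_seq1.
by move=> u; rewrite inE => /eqP ->.
Qed.

Lemma idmul0 A B : idmul A B 0.
Proof. by exists [::] => //; rewrite big_nil. Qed.

Lemma idmulD A B x y : idmul A B x -> idmul A B y -> idmul A B (x + y).
Proof.
move=> [s hs ->] [t ht ->]; exists (s ++ t); last by rewrite big_cat.
by move=> u; rewrite mem_cat => /orP[/hs|/ht].
Qed.

Lemma idmul_subm O A B : submodule O A -> submodule O (idmul A B).
Proof.
move=> hA; have hN x : idmul A B x -> idmul A B (- x).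
  have h : idmul A B `<=` [set x | idmul A B (- x)].
    apply: idmul_min => /= [|a b|a b Aa Bb]; first by rewrite oppr0; exact: idmul0.
      by rewrite opprD; apply: idmulD.
    by rewrite -mulNr; apply: idmul_in => //; apply: submN hA _.
  exact: h.
split; first exact: idmul0.
  by move=> x y hx hy; apply: idmulD => //; apply: hN.
move=> a x Oa; have h : idmul A B `<=` [set x | idmul A B (a * x)].
  apply: idmul_min => /= [|u v|u v Au Bv]; first by rewrite mulr0; exact: idmul0.
    by rewrite mulrDr; apply: idmulD.
  by rewrite mulrA; apply: idmul_in => //; apply: (submM hA).
exact: h.
Qed.

Lemma idmulC A B : idmul A B = idmul B A.
Proof.
have h (X Y : set K) : idmul X Y `<=` idmul Y X.
  apply: idmul_min => [||x y Xx Yy]; [exact: idmul0|exact: idmulD|].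
  by rewrite mulrC; apply: idmul_in.
by apply/seteqP; split.
Qed.

Lemma idmulA A B C : idmul A (idmul B C) = idmul (idmul A B) C.
Proof.
have h (X Y Z : set K) : idmul (idmul X Y) Z `<=` idmul X (idmul Y Z).
  apply: idmul_min => [||x z XYx Zz]; [exact: idmul0|exact: idmulD|].
  have: idmul X Y `<=` [set x | idmul X (idmul Y Z) (x * z)].
    apply: idmul_min => /= [|a b|a b Xa Yb]; first by rewrite mul0r; exact: idmul0.
      by rewrite mulrDl; apply: idmulD.
    by rewrite -mulrA; do 2 (apply: idmul_in => //).
  exact.
apply/seteqP; split; last exact: h.
by rewrite (idmulC A) (idmulC B) (idmulC (idmul A B)) (idmulC A); apply: h.
Qed.

Lemma idmul_mono A B C : A `<=` B -> idmul A C `<=` idmul B C.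
Proof.
move=> sAB; apply: idmul_min => [||x y Ax Cy]; [exact: idmul0|exact: idmulD|].
by apply: idmul_in => //; apply: sAB.
Qed.

Lemma idmul1 O I : O 1 -> submodule O I -> idmul O I = I.
Proof.
move=> O1 hI; apply/seteqP; split.
  apply: idmul_min; [exact: subm0 hI|by move=> *; apply: (submD hI)|exact: submM hI].
by move=> x Ix; rewrite -[x]mul1r; apply: idmul_in.
Qed.

Lemma idmul_scale x A B : idmul (idscale x A) B = idscale x (idmul A B).
Proof.
apply/seteqP; split.
  apply: idmul_min => [|_ _ [a ha <-] [b hb <-]|_ y [a Aa <-] By].
  - by exists 0; [exact: idmul0|rewrite mulr0].
  - by exists (a + b); [exact: idmulD|rewrite mulrDr].
  - by exists (a * y); [exact: idmul_in|rewrite mulrA].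
move=> _ [y hy <-]; have: idmul A B `<=` [set y | idmul (idscale x A) B (x * y)].
  apply: idmul_min => /= [|a b|a b Aa Bb]; first by rewrite mulr0; exact: idmul0.
    by rewrite mulrDr; apply: idmulD.
  by rewrite mulrA; apply: idmul_in => //; exists a.
exact.
Qed.

Lemma idscaleM x y A : idscale x (idscale y A) = idscale (x * y) A.
Proof.
apply/seteqP; split => [_ [_ [a Aa <-] <-]|_ [a Aa <-]].
  by exists a => //; rewrite mulrA.
by exists (y * a); [exists a|rewrite mulrA].
Qed.

Lemma idscale1 A : idscale 1 A = A.
Proof.
apply/seteqP; split => [_ [a Aa <-]|a Aa]; first by rewrite mul1r.
by exists a => //; rewrite mul1r.
Qed.

Lemma ringInt_int (n : int) : ringInt n%:~R.
Proof. exact: integral_id. Qed.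

Lemma ringInt_subm : submodule ringInt ringInt.
Proof.
split; [exact: integral0|exact: integral_sub|exact: integral_mul].
Qed.

Lemma qorder_int f (n : int) : qorder f n%:~R.
Proof.
by exists n, 0; split; [exact: (ringInt_int 0)|rewrite mulr0 addr0].
Qed.

Lemma qorder1 f : qorder f 1. Proof. exact: (qorder_int f 1). Qed.

Lemma qorder_sub f : qorder f `<=` ringInt.
Proof.
move=> _ [n [y [hy ->]]]; apply: (submD ringInt_subm); first exact: ringInt_int.
by apply: (submM ringInt_subm) => //; exact: (ringInt_int f).
Qed.

Lemma qorder_subm f : submodule (qorder f) (qorder f).
Proof.
split; first exact: (qorder_int f 0).
  move=> _ _ [n [y [hy ->]]] [m [z [hz ->]]]; exists (n - m), (y - z).
  by split; [exact: (submB ringInt_subm)|rewrite intrB; ring].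
move=> _ _ [n [y [hy ->]]] [m [z [hz ->]]].
exists (n * m), (n%:~R * z + m%:~R * y + f%:R * (y * z)).
split; last by rewrite intrM; ring.
have RM u v : ringInt u -> ringInt v -> ringInt (u * v).
  exact: (submM ringInt_subm).
have RI := ringInt_int.
apply: (submD ringInt_subm); last exact: RM (RI f) (RM _ _ hy hz).
by apply: (submD ringInt_subm); apply: RM.
Qed.

Lemma qorder_frac f : fractional (qorder f) (qorder f).
Proof.
split; first exact: qorder_subm.
  by exists 1; [exact: qorder1|exact: oner_neq0].
by exists 1 => [|x]; [exact: oner_neq0|rewrite mul1r].
Qed.

Lemma qorder_dvd f g : (f %| g)%N -> qorder g `<=` qorder f.
Proof.
move=> /dvdnP[k ->] _ [n [y [hy ->]]]; exists n, (k%:R * y); split.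
  by apply: (submM ringInt_subm) => //; exact: (ringInt_int k).
by rewrite natrM; ring.
Qed.

Lemma qorder_conductor f y : ringInt y -> qorder f (f%:R * y).
Proof. by move=> hy; exists 0, y; rewrite add0r. Qed.

Definition invertible O I : Prop :=
  submodule O I /\ exists2 J, submodule O J & idmul I J = O.

Lemma invertible_proper f I : invertible (qorder f) I -> proper (qorder f) I.
Proof.
move=> [hI [J hJ IJ]]; have IJ1 : idmul I J 1 by rewrite IJ; exact: qorder1.
have nz (A B : set K) : idmul A B 1 -> exists2 x, A x & x != 0.
  move=> h; apply: contrapT => h0; have: idmul A B `<=` [set 0].
    apply: idmul_min => //= [x y -> ->|x y Ax _]; first by rewrite addr0.
    have [->|x0] := eqVneq x 0; first by rewrite mul0r.
    by case: h0; exists x.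
  by move=> /(_ 1 h) /= /eqP; rewrite oner_eq0.
have [j Jj j0] : exists2 x, J x & x != 0 by apply: (nz J I); rewrite idmulC.
have [i Ii i0] := nz _ _ IJ1; split; last first.
  apply/seteqP; split => [x /= hx|x Ox y Iy]; last exact: (submM hI).
  rewrite -[x]mulr1; have: idmul I J `<=` [set y | qorder f (x * y)].
    apply: idmul_min => /= [|a b|a b Ia Jb].
    - by rewrite mulr0; apply: subm0 (qorder_subm f).
    - by rewrite mulrDr; apply: (submD (qorder_subm f)).
    - by rewrite -IJ mulrA; apply: idmul_in => //; apply: hx.
  exact.
split => //; first by exists i.
by exists j => // x Ix; rewrite -IJ mulrC; apply: idmul_in.
Qed.

Definition lat x y : set K :=
  [set z | exists a b : int, z = a%:~R * x + b%:~R * y].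

Lemma int_subgroup (P : int -> Prop) :
  P 0 -> (forall m n, P m -> P n -> P (m - n)) -> (exists2 n, P n & n != 0) ->
  exists2 k, P k /\ k != 0 & forall m, P m -> exists q, m = q * k.
Proof.
move=> P0 PB [n Pn n0].
have PN m : P m -> P (- m) by rewrite -sub0r; apply: PB.
have PD m p : P m -> P p -> P (m + p).
  by move=> hm hp; rewrite -[p]opprK; apply: PB => //; apply: PN.
have PM q m : P m -> P (q * m).
  move=> hm; have h (j : nat) : P (j%:Z * m).
    elim: j => [|j IH]; first by rewrite mul0r.
    by rewrite -addn1 PoszD mulrDl mul1r; apply: PD.
  by case: q => j; [exact: h|rewrite NegzE mulNr; apply: PN; apply: h].
pose Q (k : nat) := `[< P k%:Z >] && (0 < k)%N.
have exQ : exists k, Q k.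
  exists `|n|%N; rewrite /Q absz_gt0 n0 andbT; apply/asboolP.
  by rewrite abszE; case: (ger0P n) => _ //; apply: PN.
case: (ex_minnP exQ) => k /andP[/asboolP Pk k0] kmin.
exists k%:Z; first by split => //; rewrite eqz_nat -lt0n.
move=> m Pm; exists (m %/ k%:Z)%Z.
have hmod : (m %% k%:Z)%Z = m - (m %/ k%:Z)%Z * k%:Z.
  by apply/eqP; rewrite eq_sym subr_eq addrC -divz_eq.
have Pmod : P (m %% k%:Z)%Z by rewrite hmod; apply: PB => //; apply: PM.
have k0' : k%:Z != 0 by rewrite eqz_nat -lt0n.
have mge := modz_ge0 m k0'.
have mlt : (m %% k%:Z)%Z < k%:Z by rewrite ltz_mod.
rewrite {1}(divz_eq m k%:Z).
suff -> : (m %% k%:Z)%Z = 0 by rewrite addr0.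
move: Pmod mge mlt; case: (m %% k%:Z)%Z => // r Pr _ rk.
case: (posnP r) => [->//|r0].
have /kmin : Q r by rewrite /Q r0 andbT; apply/asboolP.
by move: rk; rewrite ltz_nat ltnNge => /negP.
Qed.

Lemma irrat x (a b : rat) : x \notin 1%VS -> a%:A + b *: x = 0 -> a = 0 /\ b = 0.
Proof.
move=> hx h; have b0 : b = 0.
  apply/eqP; apply: contraNT hx => b0.
  have -> : x = (- (a / b))%:A.
    apply: (scalerI b0); rewrite scalerA mulrN mulrCA mulfV // mulr1 scaleNr.
    by apply/eqP; rewrite -addr_eq0 addrC h.
  by rewrite memvZ ?memv_line.
split=> //; move: h; rewrite b0 scale0r addr0 => /eqP.
by rewrite scaler_eq0 oner_eq0 orbF => /eqP.
Qed.

Lemma int_alg (n : int) : (n%:~R : rat)%:A = n%:~R :> K.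
Proof. by rewrite -[LHS]/(in_alg K _) rmorph_int. Qed.

Lemma algM (a b : rat) : (a * b)%:A = a%:A * b%:A :> K.
Proof. by rewrite -!in_algE rmorphM. Qed.

Lemma algD (a b : rat) : (a + b)%:A = a%:A + b%:A :> K.
Proof. by rewrite scalerDl. Qed.

Lemma irrat_int x (a b : int) :
  x \notin 1%VS -> a%:~R + b%:~R * x = 0 -> a = 0 /\ b = 0.
Proof.
move=> hx h; have [] := @irrat x a%:~R b%:~R hx.
  by rewrite -(mulr_algl _ x) !int_alg.
by move=> /eqP + /eqP; rewrite !intr_eq0 => /eqP -> /eqP ->.
Qed.

Lemma quad_span x y : quadratic -> x \notin 1%VS ->
  exists a b : rat, y = a%:A + b *: x.
Proof.
move=> hK hx.
have fr : free [:: x; 1].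
  by rewrite free_cons span_seq1 seq1_free oner_neq0 andbT.
have bas : basis_of {:K}%VS [:: x; 1].
  by rewrite basisEfree fr hK leqnn andbT; apply/subvP => ? _; rewrite memvf.
have: y \in <<[:: x; 1%R]>>%VS by rewrite (span_basis bas) memvf.
rewrite span_cons span_seq1 => /memv_addP[_ /vlineP[b ->] [_ /vlineP[a ->] ->]].
by exists a, b; rewrite addrC.
Qed.

Lemma ex_irrat : quadratic -> exists x, x \notin 1%VS.
Proof.
move=> hK; apply: contrapT => h.
have: (\dim {:K} <= \dim (1%VS : {vspace K}))%N.
  apply: dimvS; apply/subvP => x _; apply: contrapT => hx; apply: h.
  by exists x; apply/negP.
by rewrite hK dimv1.
Qed.

Lemma ringInt_rat (a : rat) : ringInt a%:A -> exists n : int, a = n%:~R.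
Proof.
move=> [p pm pr].
have: root (map_poly intr p) a.
  rewrite -(fmorph_root (in_alg K)) -map_poly_comp.
  by rewrite (eq_map_poly (g := intr)) // => n /=; rewrite -[LHS]/(in_alg K _) rmorph_int.
rewrite -(fmorph_root (ratr : rat -> algC)) -map_poly_comp => hr.
have hA : ratr a \in Aint.
  apply: root_monic_Aint hr _ _; first exact: monic_map.
  apply/polyOverP => i; rewrite coef_map /= ratr_int; exact: intr_int.
have: (ratr a : algC) \in Num.int by apply: Cint_rat_Aint => //; exact: Crat_rat.
move=> /intrP[n hn]; exists n; apply: (fmorph_inj (ratr : rat -> algC)).
by rewrite /= hn ratr_int.
Qed.

Lemma denom2 (a b : rat) : exists m n k : int,
  [/\ k != 0, k%:~R * a = m%:~R & k%:~R * b = n%:~R].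
Proof.
exists (numq a * denq b), (numq b * denq a), (denq a * denq b); split.
- by rewrite mulf_neq0 ?denq_neq0.
- by rewrite !intrM numqE; ring.
- by rewrite !intrM numqE; ring.
Qed.

Lemma ex_sqrt_int : quadratic ->
  exists x (m : int), x \notin 1%VS /\ x ^+ 2 = m%:~R.
Proof.
move=> hK; have [x hx] := ex_irrat hK.
have [p [q hpq]] := quad_span (x * x) hK hx.
have [m [n [k [k0 hm hn]]]] := denom2 p q.
have k0K : k%:~R != 0 :> K by rewrite -int_alg scaler_eq0 oner_eq0 orbF intr_eq0.
have hxx : k%:~R * (x * x) = m%:~R + n%:~R * x.
  by rewrite hpq -(mulr_algl q) -!int_alg -hm -hn -!in_algE !rmorphM !rmorph_int; ring.
exists (2%:~R * k%:~R * x - n%:~R), (4 * k * m + n ^+ 2); split; last first.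
  transitivity (4%:R * k%:~R * (k%:~R * (x * x) - n%:~R * x) + n%:~R * n%:~R : K).
    by ring.
  by rewrite hxx; ring.
apply: contra hx => /vlineP[e he].
have -> : x = ((e + n%:~R) / (2%:~R * k%:~R))%:A.
  have -> (u v : rat) : (u / v)%:A = u%:A / v%:A :> K.
    by rewrite -[LHS]/(in_alg K _) rmorphM fmorphV.
  rewrite scalerDl -he int_alg subrK -[X in _ / X]/(in_alg K _) rmorphM !rmorph_int.
  rewrite mulrC mulKf // mulf_neq0 // -int_alg scaler_eq0 oner_eq0 orbF.
  by rewrite intr_eq0.
by rewrite memvZ ?memv_line.
Qed.

Lemma ringInt_bounded : quadratic -> exists x (N : int),
  [/\ x \notin 1%VS, ringInt x, N != 0
    & forall y, ringInt y -> exists a b : int, N%:~R * y = a%:~R + b%:~R * x].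
Proof.
move=> hK; have [x [m [hx hm]]] := ex_sqrt_int hK.
have m0 : m != 0.
  apply: contra hx => /eqP m0; move/eqP: hm; rewrite m0 expf_eq0 /= => /eqP ->.
  exact: mem0v.
have xint : ringInt x.
  exists ('X^2 - m%:P); first exact: monicXnsubC.
  by rewrite rmorphB /= map_polyXn map_polyC /= /root !hornerE hm subrr.
exists x, (2 * m); split=> //; first by rewrite mulf_neq0.
move=> y hy; have [a [b hab]] := quad_span y hK hx.
have hpow (p : {poly int}) : exists A B : rat,
    (map_poly intr p).[a%:A + b *: x] = A%:A + B *: x /\
    (map_poly intr p).[a%:A - b *: x] = A%:A - B *: x.
  elim/poly_ind: p => [|p c [A [B [h1 h2]]]].
    by exists 0, 0; rewrite rmorph0 !horner0 !scale0r subr0 addr0.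
  exists (A * a + B * b * m%:~R + c%:~R), (A * b + B * a).
  rewrite rmorphD rmorphM /= map_polyX map_polyC /= !hornerE h1 h2.
  rewrite -!(mulr_algl _ x) !algD !algM !int_alg -hm; split; ring.
have hy' : ringInt (a%:A - b *: x).
  case: hy => p pm; rewrite hab => /rootP pr; exists p => //; apply/rootP.
  have [A [B [h1 h2]]] := hpow p; move: pr; rewrite h1 h2 => h0.
  by have [-> ->] := irrat hx h0; rewrite !scale0r subr0.
have [u hu] : exists n : int, 2%:~R * a = n%:~R.
  apply: ringInt_rat.
  have -> : (2%:~R * a)%:A = y + (a%:A - b *: x) :> K.
    by rewrite hab -!(mulr_algl _ x) algM int_alg; ring.
  exact: (submD ringInt_subm).
have [v hv] : exists n : int, (2 * m)%:~R * b = n%:~R.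
  apply: ringInt_rat.
  have -> : ((2 * m)%:~R * b)%:A = x * (y - (a%:A - b *: x)) :> K.
    rewrite hab -!(mulr_algl _ x) algM int_alg intrM -hm; ring.
  by apply: (submM ringInt_subm) => //; apply: (submB ringInt_subm).
exists (m * u), v; rewrite hab -(mulr_algl b x).
have -> : (m * u)%:~R = m%:~R * (2%:~R * a%:A) :> K.
  by rewrite intrM -(int_alg u) -hu algM int_alg.
have -> : v%:~R = 2%:~R * m%:~R * b%:A :> K.
  by rewrite -(int_alg v) -hv algM int_alg intrM.
by rewrite intrM; ring.
Qed.

Lemma frac_lattice f I : quadratic -> (0 < f)%N -> fractional (qorder f) I ->
  exists al ta, [/\ al != 0, ta \notin 1%VS & I = idscale al (lat 1 ta)].
Proof.
move=> hK f0 [hI [i0 Ii0 i00] [d d0 hd]].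
have [x [N [hx xint N0 hN]]] := ringInt_bounded hK.
have int0 (n : int) : n != 0 -> n%:~R != 0 :> K.
  by move=> n0; rewrite -int_alg scaler_eq0 oner_eq0 orbF intr_eq0.
pose e := N%:~R * d; have e0 : e != 0 by rewrite mulf_neq0 ?int0.
pose M := idscale e I.
have hM : submodule (qorder f) M.
  split; first by exists 0; [exact: subm0 hI|rewrite mulr0].
    move=> _ _ [a Ia <-] [b Ib <-]; exists (a - b); last by rewrite mulrBr.
    exact: (submB hI).
  by move=> a _ Oa [b Ib <-]; exists (a * b); [exact: (submM hI)|rewrite mulrCA].
have ML y : M y -> exists a b : int, y = a%:~R + b%:~R * x.
  move=> [z Iz <-]; rewrite /e -mulrA; apply: hN; apply: (@qorder_sub f).
  exact: hd.
have MI y (n : int) : M y -> M (n%:~R * y) by apply: (submZ _ hM).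
have f0Z : f%:Z != 0 by rewrite eqz_nat -lt0n.
have Ow : qorder f (f%:R * x) by apply: qorder_conductor.
have Mw y : M y -> M (f%:R * x * y) by move=> hy; exact: (submM hM Ow).
have [k1 Mk1 k10] : exists2 n : int, M n%:~R & n != 0.
  have My : M (e * i0) by exists i0.
  have y0 : e * i0 != 0 by rewrite mulf_neq0.
  move: (e * i0) My y0 => y My y0; have [a [b hy]] := ML _ My.
  have [b0|b0] := eqVneq b 0.
    exists a; first by move: My; rewrite hy b0 mul0r addr0.
    by move: y0; rewrite hy b0 mul0r addr0; apply: contraNneq => ->.
  have [a' [b' hwy]] := ML _ (Mw _ My).
  exists (b' * a - b * a').
    have -> : (b' * a - b * a')%:~R = b'%:~R * y - b%:~R * (f%:R * x * y) :> K.
      by rewrite hwy hy intrB !intrM; ring.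
    by apply: (submB hM); apply: MI => //; apply: Mw.
  apply/negP => /eqP h.
  have /eqP : (b'%:~R + (- (b * f%:Z))%:~R * x) * y = 0.
    transitivity (b'%:~R * y - b%:~R * (f%:R * x * y)).
      by rewrite intrN intrM; ring.
    by rewrite hwy hy; transitivity ((b' * a - b * a')%:~R : K);
      [rewrite intrB !intrM; ring|rewrite h].
  rewrite mulf_eq0 (negPf y0) orbF => /eqP /(irrat_int hx)[_ /eqP].
  by rewrite oppr_eq0 mulf_eq0 (negPf b0) (negPf f0Z).
have [k [Mk k0] hk] : exists2 k : int, M k%:~R /\ k != 0 &
    forall m : int, M m%:~R -> exists q, m = q * k.
  apply: int_subgroup; [exact: subm0 hM| |by exists k1].
  by move=> m n hm hn; rewrite intrB; apply: (submB hM).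
have [n0 [[m0 Mb] n00] hn] : exists2 n0 : int,
    (exists m : int, M (m%:~R + n0%:~R * x)) /\ n0 != 0 &
    forall n : int, (exists m : int, M (m%:~R + n%:~R * x)) -> exists q, n = q * n0.
  apply: int_subgroup.
  - by exists 0; rewrite mul0r addr0; apply: subm0 hM.
  - move=> m n [m' hm] [n' hn]; exists (m' - n').
    have -> : (m' - n')%:~R + (m - n)%:~R * x =
      (m'%:~R + m%:~R * x) - (n'%:~R + n%:~R * x) by rewrite !intrB; ring.
    exact: (submB hM).
  - exists (f%:Z * k1); last by rewrite mulf_neq0.
    exists 0; have -> : 0%:~R + (f%:Z * k1)%:~R * x = f%:R * x * k1%:~R.
      by rewrite intrM; ring.
    exact: Mw.
pose be : K := m0%:~R + n0%:~R * x.
have k0K : k%:~R != 0 :> K by apply: int0.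
exists (k%:~R / e), (be / k%:~R); split.
- by rewrite mulf_neq0 // invr_eq0.
- apply/negP => /vlineP[r hr].
  have : (m0%:~R + (- k)%:~R * r)%:A + (n0%:~R : rat) *: x = 0.
    have hb : be = k%:~R * r%:A by rewrite -hr mulrC divfK.
    rewrite algD algM !int_alg -(mulr_algl _ x) int_alg.
    by rewrite intrN mulNr -hb /be; ring.
  by move=> /(irrat hx)[_ /eqP]; rewrite intr_eq0 (negPf n00).
- have MEq : M = lat k%:~R be.
    apply/seteqP; split => [z Mz|_ [a [b ->]]]; last first.
      by apply: (submD hM); apply: MI.
    have [a [b hz]] := ML _ Mz.
    have [q hq] : exists q, b = q * n0 by apply: hn; exists a; rewrite -hz.
    have [r hr] : exists r, a - q * m0 = r * k.
      apply: hk; have -> : (a - q * m0)%:~R = z - q%:~R * be.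
        by rewrite hz hq /be intrB !intrM; ring.
      by apply: (submB hM) => //; apply: MI.
    exists r, q; rewrite -intrM -hr hz hq /be intrB !intrM; ring.
  have -> : I = idscale e^-1 M by rewrite /M idscaleM mulVf // idscale1.
  rewrite [k%:~R / e]mulrC -idscaleM MEq; congr idscale.
  apply/seteqP; split => [_ [a [b ->]]|_ [_ [a [b ->]] <-]].
    exists (a%:~R * 1 + b%:~R * (be / k%:~R)); first by exists a, b.
    by field.
  by exists a, b; field.
Qed.

Lemma int_gcd3 (a b c : int) : a != 0 -> exists g a' b' c' u v w : int,
  [/\ g != 0, [/\ a = g * a', b = g * b' & c = g * c']
    & u * a' + v * b' + w * c' = 1].
Proof.
move=> a0; have [[u v] /= uv] : exists uv : int * int, uv.1 * a + uv.2 * b = gcdz a b.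
  by have [u [v h]] := Bezoutz a b; exists (u, v).
have [u' [v' uv']] := Bezoutz (gcdz a b) c.
pose g := gcdz (gcdz a b) c.
have ga : (g %| a)%Z := dvdz_trans (dvdz_gcdl _ _) (dvdz_gcdl _ _).
have gb : (g %| b)%Z := dvdz_trans (dvdz_gcdl _ _) (dvdz_gcdr _ _).
have gc : (g %| c)%Z := dvdz_gcdr _ _.
have g0 : g != 0 by apply: contraNneq a0 => h; move: ga; rewrite h dvd0z.
exists g, (a %/ g)%Z, (b %/ g)%Z, (c %/ g)%Z, (u' * u), (u' * v), v'.
split=> //; first by rewrite !(mulrC g) !divzK.
apply: (mulfI g0); rewrite mulr1.
transitivity (u' * (u * ((a %/ g)%Z * g) + v * ((b %/ g)%Z * g)) + v' * ((c %/ g)%Z * g)).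
  by ring.
by rewrite !divzK // uv.
Qed.

Lemma proper_invertible f I : quadratic -> (0 < f)%N ->
  proper (qorder f) I -> invertible (qorder f) I.
Proof.
move=> hK f0 [hI hmul]; have hIm := frac_submodule hI.
have [al [ta [al0 hta IE]]] := frac_lattice hK f0 hI.
have int0 (n : int) : n != 0 -> n%:~R != 0 :> K.
  by move=> n0; rewrite -int_alg scaler_eq0 oner_eq0 orbF intr_eq0.
have [p [q hpq]] := quad_span (ta * ta) hK hta.
have [m [n [k [k0 hm hn]]]] := denom2 p q.
have hrel : k%:~R * (ta * ta) = m%:~R + n%:~R * ta.
  by rewrite hpq -(mulr_algl q) -!int_alg -hm -hn !algM !int_alg; ring.
have [g [a [b [c [u [v [w [g0 [ka kb kc] bez]]]]]]]] := int_gcd3 (- n) (- m) k0.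
have rel : a%:~R * (ta * ta) + b%:~R * ta + c%:~R = 0.
  apply: (mulfI (int0 _ g0)); rewrite mulr0.
  transitivity ((g * a)%:~R * (ta * ta) + (g * b)%:~R * ta + (g * c)%:~R).
    by rewrite !intrM; ring.
  by rewrite -ka -kb -kc hrel !intrN; ring.
have a0 : a != 0 by apply: contraNneq k0; rewrite ka => ->; rewrite mulr0.
have hO : qorder f = lat 1 (a%:~R * ta).
  rewrite -hmul; apply/seteqP; split => [x /= hx|_ [r [s ->]] y].
    have lx y : lat 1 ta y -> lat 1 ta (x * y).
      move=> hy; have : I (x * (al * y)) by apply: hx; rewrite IE; exists y.
      by rewrite IE mulrCA => -[z hz /(mulfI al0) <-].
    have [|r [s hrs]] := lx 1; first by exists 1, 0; rewrite mul0r addr0 mulr1.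
    rewrite mulr1 in hrs.
    have [|r' [s' hrs']] := lx ta; first by exists 0, 1; rewrite mul0r add0r mul1r.
    have : (s * c + a * r')%:~R + (s * b - a * r + a * s')%:~R * ta = 0.
      have h : a%:~R * (x * ta) = a%:~R * r%:~R * ta + s%:~R * (a%:~R * (ta * ta)).
        by rewrite hrs; ring.
      have -> : (s * c + a * r')%:~R + (s * b - a * r + a * s')%:~R * ta =
        a%:~R * (r'%:~R * 1 + s'%:~R * ta) - a%:~R * r%:~R * ta
        + s%:~R * (b%:~R * ta + c%:~R).
        by rewrite !(intrD, intrM, intrN); ring.
      rewrite -hrs' h.
      transitivity (s%:~R * (a%:~R * (ta * ta) + b%:~R * ta + c%:~R)); first by ring.
      by rewrite rel mulr0.
    move=> /(irrat_int hta)[h1 h2].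
    have [t ht] : exists t, s = t * a.
      exists (u * s + v * (r - s') - w * r').
      rewrite -[LHS]mulr1 -bez.
      have h3 : s * b = a * r - a * s' by apply/eqP; rewrite -subr_eq0 -h2; apply/eqP; ring.
      have h4 : s * c = - (a * r') by apply/eqP; rewrite -addr_eq0 h1.
      transitivity (u * s * a + v * (s * b) + w * (s * c)); first by ring.
      by rewrite h3 h4; ring.
    by exists r, t; rewrite hrs ht intrM; ring.
  rewrite IE => -[_ [r' [s' ->]] <-].
  exists ((r%:~R + s%:~R * (a%:~R * ta)) * (r'%:~R + s'%:~R * ta)); last by ring.
  exists (r * r' - s * s' * c), (r * s' + s * a * r' - s * s' * b).
  rewrite !(intrD, intrM, intrN).
  transitivity (r%:~R * r'%:~R + r%:~R * s'%:~R * ta + s%:~R * a%:~R * r'%:~R * ta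
    + s%:~R * s'%:~R * (a%:~R * (ta * ta)) : K); first by ring.
  have -> : a%:~R * (ta * ta) = - (b%:~R * ta + c%:~R).
    by apply/eqP; rewrite -addr_eq0 addrA rel.
  by ring.
pose J := idscale al^-1 (lat a%:~R (a%:~R * ta + b%:~R)).
have IJ : idmul I J = qorder f.
  rewrite IE /J idmul_scale idmulC idmul_scale idscaleM mulfV // idscale1 idmulC hO.
  pose L := idmul (lat 1 ta) (lat a%:~R (a%:~R * ta + b%:~R)).
  have inL (x1 x2 y1 y2 : int) : L ((x1%:~R * 1 + x2%:~R * ta) *
      (y1%:~R * a%:~R + y2%:~R * (a%:~R * ta + b%:~R))).
    by apply: idmul_in; [exists x1, x2|exists y1, y2].
  have LD y z : L y -> L z -> L (y + z) by apply: idmulD.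
  apply/seteqP; split.
    apply: idmul_min => [|_ _ [r [s ->]] [r' [s' ->]]|_ _ [x [y ->]] [z [t ->]]].
    - by exists 0, 0; rewrite !mul0r addr0.
    - by exists (r + r'), (s + s'); rewrite !intrD; ring.
    - exists (x * z * a + x * t * b - y * t * c), (x * t + y * z).
      rewrite !(intrD, intrM, intrN).
      transitivity (x%:~R * z%:~R * a%:~R + x%:~R * t%:~R * b%:~R
        + (x%:~R * t%:~R + y%:~R * z%:~R) * a%:~R * ta
        + y%:~R * t%:~R * (a%:~R * (ta * ta) + b%:~R * ta) : K); first by ring.
      have -> : a%:~R * (ta * ta) + b%:~R * ta = - c%:~R.
        by apply/eqP; rewrite -addr_eq0 rel.
      by ring.
  move=> _ [r [s ->]].
  have -> : r%:~R * 1 + s%:~R * (a%:~R * ta) =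
     (((r * u)%:~R * 1 + (s - r * v)%:~R * ta) * (1%:~R * a%:~R + 0%:~R * (a%:~R * ta + b%:~R)))
     + (((r * v)%:~R * 1 + (- (r * w))%:~R * ta) * (0%:~R * a%:~R + 1%:~R * (a%:~R * ta + b%:~R)))
     :> K.
    rewrite !(intrD, intrM, intrN).
    have bezK : u%:~R * a%:~R + v%:~R * b%:~R + w%:~R * c%:~R = 1 :> K.
      by rewrite -!intrM -!intrD bez.
    have cE : c%:~R = - (a%:~R * (ta * ta) + b%:~R * ta).
      by apply/eqP; rewrite -addr_eq0 addrC rel.
    by rewrite -[X in _ * X + _]bezK cE; ring.
  by apply: LD; apply: inL.
split=> //; exists (idmul (qorder f) J); first by apply: idmul_subm; apply: qorder_subm.
by rewrite idmulA [idmul I _]idmulC (idmul1 (qorder1 f) hIm).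
Qed.

Record properIdeal f := ProperIdeal {
  ideal_set :> set K;
  ideal_proper : proper (qorder f) ideal_set }.

HB.instance Definition _ f := gen_eqMixin (properIdeal f).
HB.instance Definition _ f := gen_choiceMixin (properIdeal f).

Definition ideal_equiv f (I J : properIdeal f) : bool :=
  `[< exists2 x : K, x != 0 & J = idscale x I :> set K >].

Lemma ideal_equivP f (I J : properIdeal f) :
  reflect (exists2 x : K, x != 0 & J = idscale x I :> set K) (ideal_equiv I J).
Proof. exact: asboolP. Qed.

Lemma ideal_equiv_refl f : reflexive (@ideal_equiv f).
Proof.
by move=> I; apply/ideal_equivP; exists 1; [exact: oner_neq0|rewrite idscale1].
Qed.

Lemma ideal_equiv_sym f : symmetric (@ideal_equiv f).
Proof.
have h (I J : properIdeal f) : ideal_equiv I J -> ideal_equiv J I.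
  move=> /ideal_equivP[x x0 hJ]; apply/ideal_equivP; exists x^-1.
    by rewrite invr_eq0.
  by rewrite hJ idscaleM mulVf // idscale1.
by move=> I J; apply/idP/idP; apply: h.
Qed.

Lemma ideal_equiv_trans f : transitive (@ideal_equiv f).
Proof.
move=> J I L /ideal_equivP[x x0 hJ] /ideal_equivP[y y0 hL]; apply/ideal_equivP.
by exists (y * x); [rewrite mulf_neq0|rewrite hL hJ idscaleM].
Qed.

Canonical ideal_equivRel f := EquivRel (@ideal_equiv f)
  (@ideal_equiv_refl f) (@ideal_equiv_sym f) (@ideal_equiv_trans f).

Lemma idmul_qorder f I : submodule (qorder f) I -> idmul (qorder f) I = I.
Proof. by apply: idmul1; apply: qorder1. Qed.

Lemma invertible1 f : invertible (qorder f) (qorder f).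
Proof.
split; first exact: qorder_subm.
exists (qorder f); first exact: qorder_subm.
by apply: idmul_qorder; apply: qorder_subm.
Qed.

Lemma invertibleM f I J : invertible (qorder f) I -> invertible (qorder f) J ->
  invertible (qorder f) (idmul I J).
Proof.
move=> [hI [I' hI' II']] [hJ [J' hJ' JJ']]; split; first exact: idmul_subm.
exists (idmul I' J'); first exact: idmul_subm.
rewrite (idmulC I J) idmulA -(idmulA J I I') II' (idmulC J) (idmul_qorder hJ).
exact: JJ'.
Qed.

Lemma invertibleV f I : invertible (qorder f) I ->
  exists J, invertible (qorder f) J /\ idmul I J = qorder f.
Proof.
by move=> [hI [J hJ IJ]]; exists J; split=> //; split=> //; exists I => //; rewrite idmulC.
Qed.

Lemma qorder_mul_dvd f g : (f %| g)%N -> idmul (qorder g) (qorder f) = qorder f.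
Proof.
move=> /qorder_dvd sgf; apply/seteqP; split.
  by rewrite -{2}(idmul_qorder (qorder_subm f)); apply: idmul_mono.
by move=> x hx; rewrite -[x]mul1r; apply: idmul_in => //; apply: qorder1.
Qed.

Lemma invertible_ext f g I : (f %| g)%N -> invertible (qorder g) I ->
  invertible (qorder f) (idmul I (qorder f)).
Proof.
move=> fg [hI [J hJ IJ]]; have Om := qorder_subm f; split.
  by rewrite idmulC; apply: idmul_subm.
exists (idmul J (qorder f)); first by rewrite idmulC; apply: idmul_subm.
rewrite -idmulA (idmulA (qorder f)) (idmulC (qorder f) J) -(idmulA J).
by rewrite idmul_qorder // idmulA IJ qorder_mul_dvd.
Qed.

(* The class group of the order of conductor f. Its law, written additively,
   is [I] + [J] = [I J], and its zero is the class of the order itself. The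
   hypotheses are parameters because they are what makes it a group. *)
Definition classGroup (hK : quadratic) f (f0 : (0 < f)%N) : Type :=
  {eq_quot @ideal_equiv f}%qT.

Definition cl (hK : quadratic) f (f0 : (0 < f)%N) (I : properIdeal f) : @classGroup hK f f0 :=
  \pi_({eq_quot @ideal_equiv f}%qT)%qT I.

Section ClassGroup.
Variables (hK : quadratic) (f : nat) (f0 : (0 < f)%N).

Let invI (I : properIdeal f) : invertible (qorder f) I :=
  proper_invertible hK f0 (ideal_proper I).

Definition ideal_one : properIdeal f :=
  ProperIdeal (invertible_proper (invertible1 f)).

Definition ideal_mul (I J : properIdeal f) : properIdeal f :=
  ProperIdeal (invertible_proper (invertibleM (invI I) (invI J))).

Lemma ideal_inv_ex (I : properIdeal f) :
  exists J : properIdeal f, idmul I J = qorder f.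
Proof.
have [J [hJ IJ]] := invertibleV (invI I).
by exists (ProperIdeal (invertible_proper hJ)).
Qed.

Definition ideal_inv (I : properIdeal f) : properIdeal f :=
  projT1 (cid (ideal_inv_ex I)).

Lemma ideal_mulV (I : properIdeal f) : idmul I (ideal_inv I) = qorder f.
Proof. exact: projT2 (cid (ideal_inv_ex I)). Qed.

Local Notation Cl := (classGroup hK f0).
Local Notation cl := (@cl hK f f0).

HB.instance Definition _ := Choice.copy Cl {eq_quot @ideal_equiv f}%qT.

Definition rep (C : Cl) : properIdeal f := repr (C : {eq_quot @ideal_equiv f}%qT).

Lemma clP (I J : properIdeal f) : cl I = cl J <->
  exists2 x : K, x != 0 & J = idscale x I :> set K.
Proof.
split=> [/eqmodP/ideal_equivP //|h]; apply/eqmodP; exact/ideal_equivP.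
Qed.

Lemma cl_eq (I J : properIdeal f) : I = J :> set K -> cl I = cl J.
Proof. by move=> h; apply/clP; exists 1; [exact: oner_neq0|rewrite idscale1]. Qed.

Definition cl_zero : Cl := cl ideal_one.
Definition cl_add (C D : Cl) : Cl :=
  cl (ideal_mul (rep C) (rep D)).
Definition cl_opp (C : Cl) : Cl := cl (ideal_inv (rep C)).

Lemma cl_repr (C : Cl) : cl (rep C) = C.
Proof. exact: reprK. Qed.

Lemma clD (I J : properIdeal f) : cl_add (cl I) (cl J) = cl (ideal_mul I J).
Proof.
have /clP[x x0 hx] := cl_repr (cl I); have /clP[y y0 hy] := cl_repr (cl J).
apply/clP; exists (x * y); first by rewrite mulf_neq0.
by rewrite /= hx hy idmul_scale (idmulC (rep _)) idmul_scale idscaleM (idmulC (rep (cl I))).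
Qed.

Lemma cl_ind (P : Cl -> Prop) :
  (forall I : properIdeal f, P (cl I)) -> forall C : Cl, P C.
Proof. by move=> h D; rewrite -(cl_repr D). Qed.

Lemma cl_addA : associative cl_add.
Proof.
elim/cl_ind => I; elim/cl_ind => J; elim/cl_ind => L.
by rewrite !clD; apply: cl_eq; apply: idmulA.
Qed.

Lemma cl_addC : commutative cl_add.
Proof.
by elim/cl_ind => I; elim/cl_ind => J; rewrite !clD; apply: cl_eq; apply: idmulC.
Qed.

Lemma cl_add0 : left_id cl_zero cl_add.
Proof.
elim/cl_ind => I; rewrite clD; apply: cl_eq; apply: idmul_qorder.
by have [] := invI I.
Qed.

Lemma cl_addN : left_inverse cl_zero cl_opp cl_add.
Proof.
move=> C; rewrite -{2}(cl_repr C) clD; apply: cl_eq.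
by rewrite /= idmulC ideal_mulV.
Qed.

HB.instance Definition _ := GRing.isZmodule.Build Cl
  cl_addA cl_addC cl_add0 cl_addN.

End ClassGroup.

Section Extension.
Variables (hK : quadratic) (f g : nat) (f0 : (0 < f)%N) (g0 : (0 < g)%N).
Variable fg : (f %| g)%N.

Definition ideal_ext (I : properIdeal g) : properIdeal f :=
  ProperIdeal (invertible_proper
    (invertible_ext fg (proper_invertible hK g0 (ideal_proper I)))).

(* the natural map Cl(O_g) -> Cl(O_f), [I] |-> [I O_f] *)
Definition cl_ext (C : classGroup hK g0) : classGroup hK f0 :=
  cl hK f0 (ideal_ext (rep C)).

Lemma cl_extE (I : properIdeal g) : cl_ext (cl hK g0 I) = cl hK f0 (ideal_ext I).
Proof.
have /clP[x x0 hx] := cl_repr (cl hK g0 I); apply/clP; exists x => //=.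
by rewrite hx idmul_scale.
Qed.

Lemma cl_ext_additive : additive cl_ext.
Proof.
have hD : {morph cl_ext : C D / C + D}.
  elim/cl_ind => I; elim/cl_ind => J.
  rewrite -[_ + _]/(cl_add _ _) clD !cl_extE -[RHS]/(cl_add _ _) clD.
  apply: cl_eq => /=.
  rewrite -[RHS]idmulA (idmulA (qorder f)) (idmulC (qorder f) J) -(idmulA J).
  by rewrite (idmul_qorder (qorder_subm f)) idmulA.
by move=> C D; have := hD (C - D) D; rewrite subrK => ->; rewrite addrK.
Qed.

HB.instance Definition _ := GRing.isZmodMorphism.Build _ _ cl_ext cl_ext_additive.

(* For an ideal P of the maximal order coprime to the conductor g (such as
   a nonzero prime ideal not containing g), the map is [P n O_g] |-> [P n O_f]. *)
Lemma cl_ext_prime P (I : properIdeal g) (J : properIdeal f) :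
  submodule ringInt P -> P `<=` ringInt ->
  (exists a b, [/\ P a, ringInt b & a + g%:R * b = 1]) ->
  I = P `&` qorder g :> set K -> J = P `&` qorder f :> set K ->
  cl_ext (cl hK g0 I) = cl hK f0 J.
Proof.
move=> hP sP [a [b [Pa Rb ab]]] hI hJ; rewrite cl_extE; apply: cl_eq => /=.
rewrite hI hJ; have Of := qorder_subm f.
have sgf := qorder_dvd fg.
apply/seteqP; split.
  apply: idmul_min => [|x y [Px Ox] [Py Oy]|x y [Px Ox] Oy].
  - by split; [apply: subm0 hP|apply: subm0 Of].
  - by split; [apply: (submD hP)|apply: (submD Of)].
  - split; last by apply: (submM Of) => //; apply: sgf.
    by rewrite mulrC; apply: (submM hP) => //; apply: (@qorder_sub f).
move=> x [Px Ox]; have Rx := qorder_sub Ox.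
have -> : x = a * x + (x * (g%:R * b)) * 1.
  by transitivity ((a + g%:R * b) * x); [rewrite ab mul1r|ring].
apply: idmulD; apply: idmul_in => //.
- split=> //; have -> : a = 1 - g%:R * b by apply/eqP; rewrite eq_sym subr_eq ab.
  apply: (submB (qorder_subm g)); first exact: qorder1.
  exact: qorder_conductor.
- split; last first.
    rewrite mulrCA; apply: qorder_conductor; exact: (submM ringInt_subm).
  rewrite mulrC; apply: (submM hP) => //; apply: (submM ringInt_subm) => //.
  exact: (ringInt_int g).
- exact: qorder1.
Qed.

End Extension.
End Field.

(* 'I_(m.-1.+1) is 'I_m, with its Z/mZ structure, when m > 0 *)
Notation Zmod m := 'I_m.-1.+1.

(* the canonical map Z/mZ -> Z/nZ for n dividing m *)
Definition can_Zmod (m n : nat) (x : Zmod m) : Zmod n := inZp x.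

Section Tower.
Variables (K : fieldExtType rat) (hK : quadratic K) (c l : nat).
Hypotheses (c_gt0 : (0 < c)%N) (l_pr : prime l).

Lemma cond_gt0 d : (0 < c * l ^ d)%N.
Proof. by rewrite muln_gt0 c_gt0 expn_gt0 prime_gt0. Qed.

Lemma cond_dvd d d' : (d <= d')%N -> (c * l ^ d %| c * l ^ d')%N.
Proof. by move=> h; rewrite dvdn_mul // dvdn_exp2l. Qed.

(* Cl(O_d), for O_d the order of conductor c l^d *)
Definition Cl d := classGroup hK (cond_gt0 d).

Definition Cl_map d d' (h : (d <= d')%N) : {additive Cl d' -> Cl d} :=
  @cl_ext K hK _ _ (cond_gt0 d) (cond_gt0 d') (cond_dvd h).

Definition S_ d : set (Cl d) := [set C | exists k : nat, C *+ l ^ k = 0].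
Arguments S_ d : clear implicits.

Definition kappa d : set (Cl d) := [set C | S_ d C /\ Cl_map (leq0n d) C = 0].
Arguments kappa d : clear implicits.

Definition pi_ d : {additive Cl d.+1 -> Cl d} := Cl_map (leqnSn d).

Lemma pi_S d C : S_ d.+1 C -> S_ d (pi_ d C).
Proof. by move=> [k hk]; exists k; rewrite -raddfMn hk raddf0. Qed.

Lemma Cl_map_pi d C : Cl_map (leq0n d) (pi_ d C) = Cl_map (leq0n d.+1) C.
Proof.
elim/cl_ind: C => I; rewrite /pi_ /Cl_map /= !cl_extE; apply: cl_eq => /=.
by rewrite -idmulA qorder_mul_dvd //; apply: cond_dvd.
Qed.

Lemma pi_kappa d C : kappa d.+1 C -> kappa d (pi_ d C).
Proof. by move=> [hS h0]; split; [exact: pi_S|rewrite /= Cl_map_pi]. Qed.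

Definition iso_onto (G A : zmodType) (u : {additive G -> A}) (B : set A) : Prop :=
  injective u /\ range u = B.

(* kappa_d is isomorphic to G and kappa_(d+1) to G', in such a way that the map
   kappa_(d+1) -> kappa_d induced by pi_d becomes g *)
Definition kappa_model d (G G' : zmodType) (g : G' -> G) : Prop :=
  exists (u : {additive G -> Cl d}) (u' : {additive G' -> Cl d.+1}),
    [/\ iso_onto u (kappa d), iso_onto u' (kappa d.+1)
      & forall x, pi_ d (u' x) = u (g x)].

End Tower.

Arguments S_ {K} hK {c l} c_gt0 l_pr d.
Arguments kappa {K} hK {c l} c_gt0 l_pr d.
Arguments pi_ {K} hK {c l} c_gt0 l_pr d.
Arguments kappa_model {K} hK {c l} c_gt0 l_pr d {G G'} g.

(* Main.v *)
From HB Require Import structures.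
Require Import Defs.
From mathcomp Require Import all_boot all_order all_algebra all_field.
From mathcomp Require Import boolp classical_sets.
From mathcomp Require Import ring zify.

(* Locally at [l], an invertible ideal of O_d whose extension to O_0 is trivial is
   generated by one element of O_0 coprime to [l], so kappa_d is the [l]-part of
   (O_0 / l^d)^* / (Z / l^d)^* modulo the units of O_0. Write O_0 = Z[th] and let an
   element have level [j] when it is a + l^j b th with a and b prime to [l]; it then
   belongs to O_j but not to O_(j+1). Raising to the [l]-th power raises the level
   by exactly one (from some level on), so an element of level [s] generates a
   cyclic group of order l^(d - s), which exhausts the elements of level at least
   [s]. In the cases with two generators, some element [eta] of level [s] has its
   [l]-th power of level at least s + 2 (it approximates a root of unity or the
   square root of the discriminant), and it can be corrected so that its [l]-th
   power lies in O_d. The units of O_0 other than 1 and -1 only occur for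
   discriminants -3 and -4, where their order modulo 1 and -1 is 3 or 2. *)

Set Implicit Arguments.
Unset Strict Implicit.
Unset Printing Implicit Defensive.

Import Order.TTheory GRing.Theory Num.Theory.
Local Open Scope classical_set_scope.
Local Open Scope ring_scope.

(** * Ideals generated by one element locally at l *)

(** All levels come from expanding (a + b l^j th)^l. Modulo l^(j + 2) only a^l + l^(j + 1) a^(l - 1)
    b th survives, provided that (l^j th)^l lies in l^(j + 2) O_0. For l >= 3 this holds from j = 1
    on, for l = 2 from j = 2 on. Ramification improves it: [th] can be translated so that l divides
    its trace t and its norm n, and then j = 1 is enough for l = 2 and j = 0 for l >= 5. A second
    generator can only appear at the levels left out: j = 1 for l = 2 unramified, j = 0 for l = 2 or
    3 ramified. There the l-th power of 1 + l^j th is computed exactly. For ramified l its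
    coefficient along l th is 1 + t / 2 or, modulo 3, 1 - n / 3, and the residue of D modulo 16 or 9
    decides whether l divides it; this separates (b) from (c). In the unramified case l^j th has
    square zero modulo l^(j + 1) only from j = 1 on, so elements are first moved into O_1 by the
    exponent l^2 - 1, which is prime to l; hence d - 1 in (a) against d in (b). *)

Lemma prime_bezout (l k : nat) (m : int) : prime l -> ~~ (l %| m)%Z ->
  exists u v : int, u * m + v * (l ^ k)%:Z = 1.
Proof.
move=> l_pr lm; have [u [v uv]] := Bezoutz m (l ^ k)%:Z.
exists u, v; rewrite uv; apply/eqP; rewrite -/(coprimez _ _) coprimezE /=.
by rewrite coprime_sym coprimeXl // prime_coprime // -(dvdzE l).
Qed.

Lemma Euclid_dvdzM (l : nat) (a b : int) : prime l ->
  (l %| a * b)%Z = (l %| a)%Z || (l %| b)%Z.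
Proof. by move=> l_pr; rewrite !dvdzE abszM Euclid_dvdM. Qed.

Lemma invertible_one (K : fieldExtType rat) f (I : set K) :
  submodule (qorder f) I -> I `<=` qorder f -> I 1 -> I = qorder f.
Proof.
move=> hI sI I1; apply/seteqP; split=> // x Ox.
by rewrite -[x]mulr1; apply: (submM hI).
Qed.

Section Ideals.
Variables (K : fieldExtType rat) (hK : quadratic K) (c l : nat).
Hypotheses (c_gt0 : (0 < c)%N) (l_pr : prime l).

Local Notation O d := (@qorder K (c * l ^ d)).
Implicit Types (d k : nat) (I : set K) (x y z al be : K) (m : int).

Lemma ordM d x y : O d x -> O d y -> O d (x * y).
Proof. by move=> *; apply: (submM (qorder_subm K _)). Qed.

Lemma ordD d x y : O d x -> O d y -> O d (x + y).
Proof. by move=> *; apply: (submD (qorder_subm K _)). Qed.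

Lemma ordB d x y : O d x -> O d y -> O d (x - y).
Proof. by move=> *; apply: (submB (qorder_subm K _)). Qed.

Lemma ordX d x k : O d x -> O d (x ^+ k).
Proof.
move=> Ox; elim: k => [|k IH]; first exact: qorder1.
by rewrite exprS; apply: ordM.
Qed.

(** O_d is Z + l^d O_0, so [c] enters only through O_0 and everything can be read modulo l^d O_0. *)
Lemma ordP d x : O d x <-> exists a z, O 0 z /\ x = a%:~R + (l ^ d)%:R * z.
Proof.
split=> [[a [y [hy ->]]]|[a [z [[b [y [hy ->]]] ->]]]].
  exists a, (c%:R * y); split; last by rewrite natrM; ring.
  by rewrite expn0 muln1; apply: qorder_conductor.
exists (a + (l ^ d)%N%:Z * b), y; split=> //.
by rewrite expn0 muln1 natrM intrD intrM; ring.
Qed.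

Lemma ord_le d d' : (d <= d')%N -> O d' `<=` O d.
Proof. by move=> h; apply: qorder_dvd; rewrite dvdn_mul // dvdn_exp2l. Qed.

Lemma ord_conductor d z : O 0 z -> O d ((l ^ d)%:R * z).
Proof. by move=> h; apply/ordP; exists 0, z; rewrite add0r. Qed.

(** These are the elements of O_0 that become units at l; [be] and [m] play the roles of the
    conjugate and the norm of [al]. *)
Definition coprime_elt al : Prop :=
  O 0 al /\ exists be m, [/\ O 0 be, ~~ (l %| m)%Z & al * be = m%:~R].
Local Notation U := coprime_elt.

Lemma coprime_eltM al be : U al -> U be -> U (al * be).
Proof.
move=> [Oa [a' [m [Oa' lm am]]]] [Ob [b' [m' [Ob' lm' bm]]]].
split; first exact: ordM.
exists (a' * b'), (m * m'); split; first exact: ordM.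
  by rewrite Euclid_dvdzM // negb_or lm.
by rewrite intrM -am -bm; ring.
Qed.

Lemma coprime_elt_int m : ~~ (l %| m)%Z -> U m%:~R.
Proof.
move=> lm; split; first exact: qorder_int.
by exists 1, m; split; [exact: qorder1|by []|rewrite mulr1].
Qed.

Lemma coprime_elt1 : U 1.
Proof. by apply: (coprime_elt_int (m := 1)); rewrite dvdzE /= Euclid_dvd1. Qed.

Lemma coprime_eltX al k : U al -> U (al ^+ k).
Proof.
move=> Ua; elim: k => [|k IH]; first exact: coprime_elt1.
by rewrite exprS; apply: coprime_eltM.
Qed.

(** A local-global principle: multiplication by [m] tests membership at l, multiplication by l^k
    tests it away from l, and a Bezout relation glues the two. *)
Lemma coprime_cancel d k I m x : submodule (O d) I ->
  ~~ (l %| m)%Z -> I (m%:~R * x) -> I ((l ^ k)%:R * x) -> I x.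
Proof.
move=> hI lm Im Ik; have [u [v uv]] := prime_bezout k l_pr lm.
have -> : x = u%:~R * (m%:~R * x) + v%:~R * ((l ^ k)%:R * x).
  transitivity ((u * m + v * (l ^ k)%N%:Z)%:~R * x); first by rewrite uv mul1r.
  by rewrite intrD !intrM; ring.
by apply: (submD hI); apply: (submZ _ hI).
Qed.

(** At l, where [al] is invertible in O_0, the ideal al O_d = Z al + l^d al O_0 equals Z al + l^d
    O_0; away from l the latter is O_0. *)
Definition local_ideal d al : set K :=
  [set x | exists (a : int) z, O 0 z /\ x = a%:~R * al + (l ^ d)%:R * z].

Lemma local_ideal_subm d al : O 0 al -> submodule (O d) (local_ideal d al).
Proof.
move=> Oa; split.
- exists 0, 0; split; first exact: (qorder_int K _ 0).
  by rewrite mul0r mulr0 addr0.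
- move=> _ _ [a [z [Oz ->]]] [b [y [Oy ->]]]; exists (a - b), (z - y).
  by split; [exact: ordB|rewrite intrB; ring].
- move=> _ _ /ordP[b [y [Oy ->]]] [a [z [Oz ->]]].
  exists (b * a), (y * a%:~R * al + b%:~R * z + (l ^ d)%:R * y * z); split.
    have Oi := qorder_int K (c * l ^ 0).
    by do !apply: ordD; do !apply: ordM => //; apply: (Oi (l ^ d)%N%:Z).
  by rewrite intrM; ring.
Qed.

Lemma local_ideal_mem d al : local_ideal d al al.
Proof.
by exists 1, 0; rewrite mul1r mulr0 addr0; split=> //; apply: (qorder_int K _ 0).
Qed.

Lemma local_ideal_conductor d al z : O 0 z -> local_ideal d al ((l ^ d)%:R * z).
Proof. by move=> Oz; exists 0, z; rewrite mul0r add0r. Qed.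

Lemma local_ideal_sub d al : O 0 al -> local_ideal d al `<=` O 0.
Proof.
move=> Oa _ [a [z [Oz ->]]]; have Oi := qorder_int K (c * l ^ 0).
apply: ordD; apply: ordM => //; exact: (Oi (l ^ d)%N%:Z).
Qed.

Lemma local_ideal_invertible d al : U al -> invertible (O d) (local_ideal d al).
Proof.
move=> [Oa [be [m [Ob lm am]]]]; split; first exact: local_ideal_subm.
(* The product of the two ideals contains al be = m, prime to l, and l^(2 d), hence 1. *)
exists (local_ideal d be); first exact: local_ideal_subm.
have hs := idmul_subm (local_ideal d be) (local_ideal_subm d Oa).
apply: invertible_one => //.
  apply: idmul_min; [exact: subm0 (qorder_subm K _)|by move=> *; apply: ordD|].
  move=> _ _ [a [z [Oz ->]]] [b [y [Oy ->]]]; apply/ordP.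
  exists (a * b * m), (a%:~R * al * y + b%:~R * be * z + (l ^ d)%:R * z * y).
  split; last by rewrite !intrM -am; ring.
  have Oi := qorder_int K (c * l ^ 0).
  by do !apply: ordD; do !apply: ordM => //; apply: (Oi (l ^ d)%N%:Z).
apply: (coprime_cancel (k := d + d) hs lm).
  by rewrite mulr1 -am; apply: idmul_in; apply: local_ideal_mem.
rewrite mulr1 expnD natrM -[X in X * _]mulr1 -[X in _ * X]mulr1.
by apply: idmul_in; apply: local_ideal_conductor; apply: qorder1.
Qed.

Lemma local_ideal_ext d al : U al -> idmul (local_ideal d al) (O 0) = O 0.
Proof.
move=> [Oa [be [m [Ob lm am]]]].
have hs : submodule (O 0) (idmul (local_ideal d al) (O 0)).
  by rewrite idmulC; apply: idmul_subm; apply: qorder_subm.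
apply: invertible_one => //.
  apply: idmul_min; [exact: subm0 (qorder_subm K _)|by move=> *; apply: ordD|].
  by move=> x y /(local_ideal_sub Oa); apply: ordM.
apply: (coprime_cancel (k := d) hs lm).
  by rewrite mulr1 -am; apply: idmul_in => //; apply: local_ideal_mem.
apply: idmul_in; last exact: qorder1.
by rewrite -[X in local_ideal _ _ X]mulr1; apply: local_ideal_conductor; apply: qorder1.
Qed.

Lemma ext_sub I : idmul I (O 0) = O 0 -> I `<=` O 0.
Proof.
by move=> hI x Ix; rewrite -hI -[x]mulr1; apply: idmul_in => //; apply: qorder1.
Qed.

Lemma ext_conductor d I z : submodule (O d) I -> idmul I (O 0) = O 0 ->
  O 0 z -> I ((l ^ d)%:R * z).
Proof.
move=> hI hE; rewrite -hE => hz.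
have: idmul I (O 0) `<=` [set z | I ((l ^ d)%:R * z)].
  apply: idmul_min => /= [|x y|x y Ix Oy]; first by rewrite mulr0; apply: subm0 hI.
    by rewrite mulrDr; apply: (submD hI).
  by rewrite mulrCA mulrC; apply: (submM hI) => //; apply: ord_conductor.
exact.
Qed.

Lemma ext_inverse d I J : idmul I J = O d -> idmul I (O 0) = O 0 ->
  idmul J (O 0) = O 0.
Proof.
move=> IJ IO; rewrite -{1}IO idmulA (idmulC J) IJ.
by rewrite qorder_mul_dvd // dvdn_mul // dvdn_exp2l.
Qed.

(** This is prime avoidance above l. It stays a hypothesis until coordinates on O_0 are available,
    in [generates_has_coprime]. *)
Definition has_coprime : Prop :=
  forall d I, submodule (O d) I -> idmul I (O 0) = O 0 -> exists2 al, I al & U al.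

(** * Classes of elements coprime to l *)

Section WithCoprime.
Hypothesis hcop : has_coprime.

Lemma coprime_elt_lmul z : O 0 z -> ~ U (l%:R * z).
Proof.
move=> Oz [_ [be [m [Ob lm lz]]]]; have := qorder_sub (ordM Oz Ob).
have l0 : (l%:R : rat) != 0 by rewrite pnatr_eq0 -lt0n prime_gt0.
have -> : z * be = (l%:R^-1 * m%:~R : rat)%:A.
  have -> : (l%:R^-1 * m%:~R : rat)%:A = l%:R^-1 * m%:~R :> K.
    by rewrite algM int_alg -in_algE fmorphV rmorph_nat.
  rewrite -lz -mulrA mulKf //.
  by rewrite -(rmorph_nat (in_alg K)) fmorph_eq0.
move=> /ringInt_rat[q /(congr1 ( *%R l%:R))]; rewrite mulVKf // => /eqP.
rewrite -[l%:R]/(l%:Z%:~R) -intrM eqr_int => /eqP mE.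
by move: lm; rewrite mE dvdz_mulr.
Qed.

Lemma coprime_elt_residue d a z : (0 < d)%N -> O 0 z ->
  U (a%:~R + (l ^ d)%:R * z) -> ~~ (l %| a)%Z.
Proof.
case: d => // d _ Oz; apply: contraPN => /dvdzP[q ->].
have -> : (q * l)%:~R + (l ^ d.+1)%:R * z = l%:R * (q%:~R + (l ^ d)%:R * z).
  by rewrite expnS natrM intrM; ring.
apply: coprime_elt_lmul; apply: ordD; first exact: qorder_int.
by apply: ordM => //; apply: (qorder_int K _ (l ^ d)%N).
Qed.

Lemma local_ideal_unique d I al : invertible (O d) I -> idmul I (O 0) = O 0 ->
  I al -> U al -> I = local_ideal d al.
Proof.
move=> [hI [J hJ IJ]] IO Ia Ua; have hIO := ext_sub IO; have Oa := hIO _ Ia.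
apply/seteqP; split=> [x Ix|_ [a [z [Oz ->]]]]; last first.
  by apply: (submD hI); [exact: (submZ _ hI)|exact: ext_conductor].
case: (posnP d) => [->|d0].
  by exists 0, x; rewrite expn0 mul0r add0r mul1r; split=> //; apply: hIO.
(* A coprime element j of the inverse J carries I into O_d: modulo l^d O_0, x j and al j are
   integers a and b, with b prime to l as d > 0. Multiplying b x j - a al j by j', where j j' = m,
   puts m b x in Z al + l^d O_0. *)
have [j Jj Uj] := hcop hJ (ext_inverse IJ IO).
have /ordP[a [z [Oz xj]]] : O d (x * j) by rewrite -IJ; apply: idmul_in.
have /ordP[b [y [Oy aj]]] : O d (al * j) by rewrite -IJ; apply: idmul_in.
have lb : ~~ (l %| b)%Z.
  by apply: (@coprime_elt_residue d b y) => //; rewrite -aj; apply: coprime_eltM.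
have [Oj [j' [m [Oj' lm jm]]]] := Uj.
have lmb : ~~ (l %| m * b)%Z by rewrite Euclid_dvdzM // negb_or lm.
apply: (coprime_cancel (k := d) (local_ideal_subm d Oa) lmb); last first.
  by apply: local_ideal_conductor; apply: hIO.
exists (m * a), (j' * (b%:~R * z - a%:~R * y)); split.
  have Oi := qorder_int K (c * l ^ 0).
  by apply: ordM => //; apply: ordB; apply: ordM.
rewrite !intrM -jm.
have h : b%:~R * (x * j) - a%:~R * (al * j) = (l ^ d)%:R * (b%:~R * z - a%:~R * y).
  by rewrite aj xj; ring.
transitivity (a%:~R * j' * (al * j) + j' * (b%:~R * (x * j) - a%:~R * (al * j))).
  by ring.
by rewrite h; ring.
Qed.

(* The class of the ideal of [O_d] that is generated by [al] locally at [l] and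
   is [O_0] away from [l]; it is set to 0 when [al] is not coprime to [l]. *)
Definition local_class d al : Cl hK c_gt0 l_pr d :=
  if pselect (U al) is left h
  then cl hK (cond_gt0 c_gt0 l_pr d)
         (@Defs.ProperIdeal K _ _ (invertible_proper (local_ideal_invertible d h)))
  else 0.

Lemma local_classE d al (I : properIdeal K (c * l ^ d)) :
  U al -> idmul I (O 0) = O 0 -> ideal_set I al ->
  cl hK (cond_gt0 c_gt0 l_pr d) I = local_class d al.
Proof.
move=> Ua IO Ia; rewrite /local_class; case: pselect => // h; apply: cl_eq => /=.
apply: local_ideal_unique => //.
exact: (proper_invertible hK (cond_gt0 c_gt0 l_pr d) (ideal_proper I)).
Qed.

Lemma local_class_repr d al : U al -> exists I : properIdeal K (c * l ^ d),
  [/\ I = local_ideal d al :> set K, idmul I (O 0) = O 0, ideal_set I al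
    & local_class d al = cl hK (cond_gt0 c_gt0 l_pr d) I].
Proof.
move=> Ua; rewrite /local_class; case: pselect => // h.
exists (@Defs.ProperIdeal K _ _ (invertible_proper (local_ideal_invertible d h))).
by split=> //=; [exact: local_ideal_ext|exact: local_ideal_mem].
Qed.

Lemma local_classM d al be : U al -> U be ->
  local_class d (al * be) = local_class d al + local_class d be.
Proof.
move=> Ua Ub; have [I [_ IO Ia ->]] := local_class_repr d Ua.
have [J [_ JO Jb ->]] := local_class_repr d Ub.
rewrite -[RHS]/(cl_add _ _) clD; symmetry; apply: local_classE => /=.
- exact: coprime_eltM.
- by rewrite -idmulA JO.
- exact: idmul_in.
Qed.

Lemma local_class1 d al : U al -> O d al -> local_class d al = 0.
Proof.
move=> Ua Oa; symmetry; apply: (@local_classE d al (ideal_one K (c * l ^ d))) => //=.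
by rewrite qorder_mul_dvd // dvdn_mul // dvdn_exp2l.
Qed.

Lemma local_classX d al k : U al -> local_class d (al ^+ k) = local_class d al *+ k.
Proof.
move=> Ua; elim: k => [|k IH].
  by rewrite expr0 mulr0n local_class1 //; [exact: coprime_elt1|exact: qorder1].
by rewrite exprS local_classM ?IH ?mulrS //; apply: coprime_eltX.
Qed.

(** A trivial class means that [local_ideal d al] is x O_d; extending both sides to O_0 gives O_0 =
    x O_0, so x is a unit. *)
Lemma local_class_eq0 d al : U al -> local_class d al = 0 ->
  exists x y, [/\ al = x * y, O d y, O 0 x & exists2 x', O 0 x' & x * x' = 1].
Proof.
move=> Ua; have [I [_ IO Ia ->]] := local_class_repr d Ua.
rewrite -[0]/(cl hK (cond_gt0 c_gt0 l_pr d) (ideal_one K (c * l ^ d))) => /esym/clP[x x0 /= IE].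
have xO : idscale x (O 0) = O 0.
  rewrite -{2}IO IE idmul_scale qorder_mul_dvd //.
  by rewrite dvdn_mul // dvdn_exp2l.
move: Ia; rewrite IE => -[y Oy xy]; exists x, y; split=> //.
  by rewrite -xO; exists 1; [exact: qorder1|rewrite mulr1].
have : O 0 1 by exact: qorder1.
by rewrite -[X in X 1]xO => -[x' Ox' h]; exists x'.
Qed.

Lemma local_class_ext0 d al : U al ->
  Cl_map hK c_gt0 l_pr (leq0n d) (local_class d al) = 0.
Proof.
move=> Ua; have [I [_ IO Ia ->]] := local_class_repr d Ua.
by rewrite /Cl_map /= cl_extE; apply: cl_eq => /=.
Qed.

Lemma pi_local_class d al : U al ->
  pi_ hK c_gt0 l_pr d (local_class d.+1 al) = local_class d al.
Proof.
move=> Ua; have [I [_ IO Ia ->]] := local_class_repr d.+1 Ua.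
rewrite /pi_ /Cl_map /= cl_extE; apply: local_classE => //=.
  by rewrite -idmulA qorder_mul_dvd // dvdn_mul // dvdn_exp2l.
by rewrite -[al]mulr1; apply: idmul_in => //; apply: qorder1.
Qed.

Lemma ext0_local_class d (C : Cl hK c_gt0 l_pr d) :
  Cl_map hK c_gt0 l_pr (leq0n d) C = 0 -> exists2 al, U al & C = local_class d al.
Proof.
elim/cl_ind: C => I; rewrite /Cl_map /= cl_extE.
move=> /esym/clP[x x0 /= IO].
have hI := frac_submodule (ideal_proper I).1.
(* The extension of I is x O_0; dividing I by x stays in its class and makes the extension equal to
   O_0. *)
have hJ : submodule (O d) (idscale x^-1 I).
  split; first by exists 0; [exact: subm0 hI|rewrite mulr0].
    by move=> _ _ [a Ia <-] [b Ib <-]; exists (a - b); [exact: (submB hI)|rewrite mulrBr].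
  by move=> a _ Oa [b Ib <-]; exists (a * b); [exact: (submM hI)|rewrite mulrCA].
have JO : idmul (idscale x^-1 I) (O 0) = O 0.
  by rewrite idmul_scale IO idscaleM mulVf // idscale1.
have [al Ja Ua] := hcop hJ JO; exists al => //.
have [J [JE _ _ ->]] := local_class_repr d Ua; apply/clP; exists x^-1.
  by rewrite invr_eq0.
rewrite JE; symmetry; apply: local_ideal_unique => //.
have [_ [L hL IL]] := proper_invertible hK (cond_gt0 c_gt0 l_pr d) (ideal_proper I).
split=> //; exists (idscale x L).
  split; first by exists 0; [exact: subm0 hL|rewrite mulr0].
    by move=> _ _ [a Ia <-] [b Ib <-]; exists (a - b); [exact: (submB hL)|rewrite mulrBr].
  by move=> a _ Oa [b Ib <-]; exists (a * b); [exact: (submM hL)|rewrite mulrCA].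
by rewrite idmul_scale (idmulC I) idmul_scale idscaleM mulVf // idscale1 idmulC.
Qed.

Lemma Cl_map0_id (C : Cl hK c_gt0 l_pr 0) (h : (0 <= 0)%N) :
  Cl_map hK c_gt0 l_pr h C = C.
Proof.
elim/cl_ind: C => I; rewrite /Cl_map /= cl_extE; apply: cl_eq => /=.
have [hI _] := proper_invertible hK (cond_gt0 c_gt0 l_pr 0) (ideal_proper I).
by rewrite idmulC idmul_qorder.
Qed.

Lemma kappa0 : kappa hK c_gt0 l_pr 0 = [set 0].
Proof.
apply/seteqP; split=> [C [_]|_ ->]; first by rewrite Cl_map0_id.
by split; [exists 0%N; rewrite mul0rn|rewrite raddf0].
Qed.

Lemma kappaP d (C : Cl hK c_gt0 l_pr d) : kappa hK c_gt0 l_pr d C <->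
  exists al, [/\ U al, C = local_class d al & exists k, C *+ l ^ k = 0].
Proof.
split=> [[hS /ext0_local_class[al Ua CE]]|[al [Ua -> hS]]].
  by exists al; split; [|rewrite CE|exact: hS].
by split=> //; apply: local_class_ext0.
Qed.
End WithCoprime.
End Ideals.

Arguments local_class1 {K hK c l c_gt0 l_pr} hcop {d al}.
Arguments local_classM {K hK c l c_gt0 l_pr} hcop d {al be}.
Arguments local_classX {K hK c l c_gt0 l_pr} hcop d {al} k.
Arguments pi_local_class {K hK c l c_gt0 l_pr} hcop d {al}.

(** * Levels *)

Lemma Fp_int_eq0 (l : nat) (a : int) : prime l ->
  (a%:~R == 0 :> 'F_l) = (l %| a)%Z.
Proof.
move=> l_pr; have hn (m : nat) : (m%:~R == 0 :> 'F_l) = (l %| m)%N.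
  by rewrite (dvdn_pcharf (pchar_Fp l_pr)).
case: a => m; first by rewrite hn dvdzE.
by rewrite NegzE mulrNz oppr_eq0 hn dvdzE abszN.
Qed.

Lemma exp_coef_rec (R : comNzRingType) (a b : R) k :
  a * (k%:R * a ^+ k * b) + a * (a ^+ k * b) = k.+1%:R * a ^+ k.+1 * b.
Proof. by rewrite -natr1 exprS; ring. Qed.

Lemma level_step_solution (F : fieldType) (a b a' b' : F) k : a != 0 -> b' != 0 ->
  a * (- (a' * b / (a * b')) * a' ^+ k * b') + a' * (a' ^+ k * b) = 0.
Proof. by move=> ha hb; field; rewrite ha hb. Qed.

Lemma binomial_tail (R : comNzRingType) (a x : R) l : (1 < l)%N ->
  (a + x) ^+ l - a ^+ l - l%:R * a ^+ l.-1 * x =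
  \sum_(i < l.-1) a ^+ (l - i.+2) * x ^+ i.+2 *+ 'C(l, i.+2).
Proof.
case: l => [|[|l]] // _; rewrite exprDn !big_ord_recl /= expr0 bin0 mulr1 mulr1n subn0.
rewrite subn1 expr1 bin1 /= -mulr_natl.
by set S := (_ *+ _ + bigop _ _ _); ring.
Qed.

(** [t] and [n] are the trace and the norm of [th], and t^2 - 4 n is the discriminant of the order
    of conductor [c]. Coordinates are required for all conductors c f at once, so that one [th]
    serves every O_d. *)
Definition generates (K : fieldExtType rat) (c : nat) (th : K) (t n : int) : Prop :=
  [/\ th \notin 1%VS, th ^+ 2 = t%:~R * th - n%:~R
    & forall f x, qorder (c * f) x <->
        exists a b : int, x = a%:~R + b%:~R * (f%:R * th)].

Section Levels.
Variables (K : fieldExtType rat) (c l : nat) (th : K) (t n : int).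
Hypotheses (l_pr : prime l) (gen : generates c th t n).

Local Notation O d := (@qorder K (c * l ^ d)).
Local Notation U := (@coprime_elt K c l).
Local Notation "[ 'F' a ]" := (a%:~R : 'F_l) (a at level 200).
Implicit Types (i j k d s : nat) (a b p q : int) (al be ga : K).

Let th_irr : th \notin 1%VS. Proof. by case: gen. Qed.
Let th2 : th * th = t%:~R * th - n%:~R. Proof. by case: gen => _ <-. Qed.

Let ordE d x : O d x <-> exists a b : int, x = a%:~R + b%:~R * ((l ^ d)%:R * th).
Proof. by case: gen. Qed.

Let ord0 x : O 0 x <-> exists a b : int, x = a%:~R + b%:~R * th.
Proof. by rewrite ordE expn0; split=> -[a [b ->]]; exists a, b; rewrite mul1r. Qed.

Let ord_th : O 0 th.
Proof. by apply/ord0; exists 0, 1; rewrite add0r mul1r. Qed.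

Lemma repr_inj j a b a' b' :
  a%:~R + b%:~R * ((l ^ j)%:R * th) = a'%:~R + b'%:~R * ((l ^ j)%:R * th) ->
  a = a' /\ b = b'.
Proof.
move=> h; have /(irrat_int th_irr)[/eqP + /eqP] :
    (a - a')%:~R + ((b - b') * (l ^ j)%N%:Z)%:~R * th = 0.
  by rewrite intrM !intrB; move/eqP: h; rewrite -subr_eq0 => /eqP <-; ring.
rewrite subr_eq0 => /eqP ->; rewrite mulf_eq0 subr_eq0 => /orP[/eqP -> //|].
by rewrite eqz_nat expn_eq0 eqn0Ngt prime_gt0.
Qed.

(** The integer is the norm of p + q th, and the cofactor is its conjugate, obtained from th -> t -
    th. *)
Lemma coprime_elt_norm p q : ~~ (l %| p ^+ 2 + t * p * q + n * q ^+ 2)%Z ->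
  U (p%:~R + q%:~R * th).
Proof.
move=> h; split; first by apply/ord0; exists p, q.
exists ((p + t * q)%:~R + (- q)%:~R * th), (p ^+ 2 + t * p * q + n * q ^+ 2).
split=> //; first by apply/ord0; exists (p + t * q), (- q).
rewrite !(intrD, intrM, intrN).
transitivity (p%:~R * p%:~R + p%:~R * t%:~R * q%:~R + q%:~R * t%:~R * q%:~R * th
  - q%:~R * q%:~R * (th * th) : K); first by ring.
by rewrite th2; ring.
Qed.

Lemma generates_has_coprime : @has_coprime K c l.
Proof.
move=> d I hI IO; have hIO := ext_sub IO.
have [u [v [Iu Iv uv]]] : exists u v, [/\ I u, I v & 1 = u + v * th].
  have: idmul I (O 0) `<=` [set x | exists u v, [/\ I u, I v & x = u + v * th]].
    apply: idmul_min => /= [|_ _ [u [v [Iu Iv ->]]] [u' [v' [Iu' Iv' ->]]]|].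
    - by exists 0, 0; rewrite mul0r addr0; split=> //; apply: subm0 hI.
    - exists (u + u'), (v + v'); split; [exact: (submD hI)|exact: (submD hI)|ring].
    - move=> x _ Ix /ord0[a [b ->]]; exists (a%:~R * x), (b%:~R * x).
      by split; [exact: (submZ _ hI)|exact: (submZ _ hI)|ring].
  by apply; rewrite IO; apply: qorder1.
have /ord0[p [q vE]] := hIO _ Iv.
have uE : u = (1 + q * n)%:~R + (- (p + q * t))%:~R * th.
  have -> : u = 1 - v * th by rewrite uv addrK.
  rewrite vE !(intrN, intrD, intrM).
  transitivity (1 - p%:~R * th - q%:~R * (th * th)); first by ring.
  by rewrite th2; ring.
(* Let N be the norm of v = p + q th. If l does not divide N, take v. If l divides N and q, it
   divides p, and u is 1 modulo l. Otherwise q u + (p + q t) v is the integer q + N, since the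
   coordinates along th cancel. *)
have [hv|lv] := boolP (l %| p ^+ 2 + t * p * q + n * q ^+ 2)%Z; last first.
  by exists v => //; rewrite vE; apply: coprime_elt_norm.
have [lq|lq] := boolP (l %| q)%Z.
  exists u => //; rewrite uE; apply: coprime_elt_norm.
  have lp : (l %| p)%Z.
    have : (l %| p ^+ 2)%Z.
      move: hv lq; rewrite -!(Fp_int_eq0 _ l_pr) !(intrD, intrM) => + /eqP h.
      by rewrite h !(mulr0, addr0, expr2).
    by rewrite expr2 Euclid_dvdzM // orbb.
  move: lp lq; rewrite -!(Fp_int_eq0 _ l_pr) !(intrD, intrM, intrN) => /eqP -> /eqP ->.
  by rewrite !(mulr0, mul0r, addr0, oppr0, mulr1, expr2) oner_eq0.
exists (q + (p ^+ 2 + t * p * q + n * q ^+ 2))%:~R.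
  have -> : (q + (p ^+ 2 + t * p * q + n * q ^+ 2))%:~R =
      q%:~R * u + (p + q * t)%:~R * v.
    by rewrite vE uE !(intrD, intrM, intrN); ring.
  by apply: (submD hI); apply: (submZ _ hI).
apply: coprime_elt_int => //; apply: contra lq.
by rewrite -!(Fp_int_eq0 _ l_pr) in hv *; rewrite intrD (eqP hv) addr0.
Qed.

Definition repr_at j al a b : Prop := al = a%:~R + b%:~R * ((l ^ j)%:R * th).

Definition at_level j al : Prop :=
  exists a b, [/\ repr_at j al a b, [F a] != 0 & [F b] != 0].

(* [(l ^ j * th) ^+ 2] vanishes modulo [l ^ j.+1] *)
Definition nilp j : Prop := (0 < j)%N \/ (l %| t)%Z /\ (l %| n)%Z.

Lemma nilpS j : nilp j.+1. Proof. by left. Qed.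

Lemma nilp_le i j : nilp i -> (i <= j)%N -> nilp j.
Proof. by move=> [i0 h|h _]; [left; apply: leq_trans h|right]. Qed.

Lemma Fl0 : [F (l : int)] = 0.
Proof. by apply/eqP; rewrite Fp_int_eq0 // dvdzz. Qed.

(** Modulo l the coordinates multiply as in the dual numbers, with l^j th as the element of square
    zero. *)
Lemma repr_mul j al be a b a' b' : nilp j ->
  repr_at j al a b -> repr_at j be a' b' ->
  exists a'' b'', [/\ repr_at j (al * be) a'' b'', [F a''] = [F a] * [F a']
    & [F b''] = [F a] * [F b'] + [F a'] * [F b]].
Proof.
move=> hj -> ->; pose L := (l ^ j)%N%:Z.
exists (a * a' - b * b' * (L * L * n)), (a * b' + a' * b + b * b' * (L * t)).
have [hn ht] : [F (L * L * n)] = 0 /\ [F (L * t)] = 0.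
  case: hj => [|[lt ln]]; last first.
    by rewrite !intrM; move: lt ln; rewrite -!Fp_int_eq0 // => /eqP -> /eqP ->; rewrite !mulr0.
  rewrite /L; case: (j) => // i _; rewrite expnS PoszM !intrM Fl0.
  by rewrite !mul0r.
split.
- rewrite /repr_at !(intrD, intrM, intrN) /L.
  transitivity (a%:~R * a'%:~R + (a%:~R * b'%:~R + a'%:~R * b%:~R) * ((l ^ j)%:R * th)
    + b%:~R * b'%:~R * (l ^ j)%:R * (l ^ j)%:R * (th * th) : K); first by ring.
  by rewrite th2; ring.
- by rewrite intrB [X in _ - X]intrM hn mulr0 subr0 intrM.
- by rewrite intrD [X in _ + X]intrM ht mulr0 addr0 intrD !intrM.
Qed.

(** The derivative k a^(k - 1) b is stated after multiplication by a, which avoids the exponent k -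
    1 at k = 0. *)
Lemma repr_exp j al a b k : nilp j -> repr_at j al a b ->
  exists a' b', [/\ repr_at j (al ^+ k) a' b', [F a'] = [F a] ^+ k
    & [F a] * [F b'] = k%:R * [F a] ^+ k * [F b]].
Proof.
move=> hj h; elim: k => [|k [a1 [b1 [h1 ha hb]]]].
  by exists 1, 0; rewrite /repr_at !expr0 mul0r addr0; split=> //; rewrite mulr0 !mul0r.
have [a2 [b2 [h2 ha2 hb2]]] := repr_mul hj h h1.
exists a2, b2; split; first by rewrite exprS.
  by rewrite ha2 ha exprS.
by rewrite hb2 mulrDr hb ha exp_coef_rec.
Qed.

(** The first coordinate of al be is a p modulo l, and it is the integer m, prime to l. *)
Lemma coprime_repr j al a b : nilp j -> U al -> repr_at j al a b -> [F a] != 0.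
Proof.
move=> hj [_ [be [m [/ord0[p [q ->]] lm am]]]] h; apply: contra lm => a0.
have /(@repr_inj 0)[-> _] : m%:~R + 0%:~R * ((l ^ 0)%:R * th) =
    (a * p - b * q * ((l ^ j)%N%:Z * n))%:~R
    + (a * q + b * p * (l ^ j)%N + b * q * (l ^ j)%N * t)%:~R * ((l ^ 0)%:R * th).
  rewrite mul0r addr0 -am h !(intrD, intrM, intrN) mul1r.
  transitivity (a%:~R * p%:~R + (a%:~R * q%:~R + b%:~R * p%:~R * (l ^ j)%:R) * th
    + b%:~R * q%:~R * (l ^ j)%:R * (th * th) : K); first by ring.
  by rewrite th2; ring.
rewrite -Fp_int_eq0 // intrB !intrM (eqP a0) mul0r sub0r oppr_eq0.
suff -> : [F (l ^ j)%N%:Z] * [F n] = 0 by rewrite mulr0.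
case: hj => [|[_]]; last by rewrite -Fp_int_eq0 // => /eqP ->; rewrite mulr0.
by case: (j) => // i _; rewrite expnS PoszM intrM Fl0 !mul0r.
Qed.

Lemma repr_next j al a b : repr_at j al a b -> [F b] = 0 -> O j.+1 al.
Proof.
move=> -> /eqP; rewrite Fp_int_eq0 // => /dvdzP[q ->]; apply/ordE; exists a, q.
by rewrite expnS natrM intrM; ring.
Qed.

Lemma ord_repr_lower i j al : (i < j)%N -> O j al ->
  exists a b, repr_at i al a b /\ [F b] = 0.
Proof.
move=> ij /(ord_le ij)/ordE[a [b ->]]; exists a, (l%:Z * b); split.
  by rewrite /repr_at expnS natrM intrM; ring.
by rewrite intrM Fl0 mul0r.
Qed.

Lemma at_level_ord j d al : at_level j al -> O d al -> (d <= j)%N.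
Proof.
move=> [a [b [h _ hb]]] hO; rewrite leqNgt; apply: contra hb => jd.
have [a' [b' [h' b0]]] := ord_repr_lower jd hO.
by move: h; rewrite h' => /repr_inj[_ <-]; rewrite b0.
Qed.

Lemma at_levelX j al k : nilp j -> at_level j al -> coprime l k ->
  at_level j (al ^+ k).
Proof.
move=> hj [a [b [h ha hb]]] lk; have [a' [b' [h' ha' hb']]] := repr_exp k hj h.
exists a', b'; split=> //; first by rewrite ha' expf_eq0 (negPf ha) andbF.
have : [F a] * [F b'] != 0.
  rewrite hb' !mulf_neq0 ?expf_neq0 //.
  by rewrite -(dvdn_pcharf (pchar_Fp l_pr)) -prime_coprime.
by apply: contraNneq => ->; rewrite mulr0.
Qed.

Lemma at_levelMr j al be : nilp j -> at_level j al -> U be -> O j.+1 be ->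
  at_level j (al * be).
Proof.
move=> hj [a [b [h ha hb]]] Ub Ob.
have [a' [b' [h' b0]]] := ord_repr_lower (ltnSn j) Ob.
have a'0 := coprime_repr hj Ub h'.
have [a2 [b2 [h2 ha2 hb2]]] := repr_mul hj h h'.
by exists a2, b2; split; rewrite ?ha2 ?hb2 ?b0 ?mulr0 ?add0r // mulf_neq0.
Qed.

(** The quotient b / a modulo l turns products into sums; that of [ga] is nonzero, hence generates
    F_l, and some power of [ga] cancels that of [al]. *)
Lemma level_step j al ga : nilp j -> at_level j ga -> U al -> O j al ->
  exists k, O j.+1 (al * ga ^+ k).
Proof.
move=> hj [a' [b' [h' ha' hb']]] Ua /ordE[a [b h]].
have ha := coprime_repr hj Ua h.
pose x : 'F_l := - ([F a'] * [F b] / ([F a] * [F b'])).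
have [k kx] : exists k : nat, k%:R = x by exists x; exact: natr_Zp.
exists k; have [a1 [b1 [h1 ha1 hb1]]] := repr_exp k hj h'.
have [a2 [b2 [h2 _ hb2]]] := repr_mul hj h h1.
apply: (repr_next h2); apply: (mulfI ha'); rewrite mulr0 hb2 mulrDr ha1.
rewrite mulrCA hb1 kx /x; exact: level_step_solution.
Qed.

(** At level j the correcting factor is a power of ga^(l^(j - s)), so the total exponent stays a
    multiple of l^(i - s). For i = s + 1 the correction is thus an l-th power, as
    [kappa_model_split] requires. *)
Lemma level_descent s i j al ga : nilp s -> (s <= i <= j)%N ->
  (forall j, (s <= j)%N -> at_level j (ga ^+ (l ^ (j - s)))) -> U ga ->
  U al -> O i al -> exists k, O j (al * ga ^+ (l ^ (i - s) * k)).
Proof.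
move=> hs /andP[si ij] hga Ug Ua Oa; elim: j ij => [|j IH].
  by rewrite leqn0 => /eqP <-; exists 0%N; rewrite muln0 mulr1.
rewrite leq_eqVlt => /predU1P[<-|]; first by exists 0%N; rewrite muln0 mulr1.
rewrite ltnS => ij; have sj := leq_trans si ij.
have {IH}[k hk] := IH ij.
have Uk : U (al * ga ^+ (l ^ (i - s) * k)).
  by apply: coprime_eltM => //; apply: coprime_eltX.
have [k' hk'] := level_step (nilp_le hs sj) (hga j sj) Uk hk.
exists (k + l ^ (j - i) * k')%N; move: hk'.
rewrite -mulrA -exprM -exprD mulnDr mulnA -expnD.
by rewrite [(i - s + _)%N]addnC addnBA // subnK.
Qed.

(** * Raising to the l-th power *)

Definition level_sequence s ga : Prop :=
  forall j, (s <= j)%N -> at_level j (ga ^+ (l ^ (j - s))).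

Definition power_small j : Prop :=
  exists2 z, O 0 z & ((l ^ j)%:R * th) ^+ l = (l ^ j.+2)%:R * z.

Lemma nilp_sqr j : nilp j ->
  exists2 z, O 0 z & ((l ^ j)%:R * th) ^+ 2 = (l ^ j.+1)%:R * z.
Proof.
rewrite exprMn (expr2 th) th2 => -[|[/dvdzP[t' ->] /dvdzP[n' ->]]].
  case: j => // j _; exists ((l ^ j)%:R * (t%:~R * th - n%:~R)).
    apply: ordM; first exact: (qorder_int K _ (l ^ j)%N).
    by apply/ord0; exists (- n), t; rewrite intrN; ring.
  rewrite -natrX -expnM mulrA -natrM -expnD; congr ((l ^ _)%:R * _); lia.
exists ((l ^ j)%:R * (t'%:~R * th - n'%:~R)).
  apply: ordM; first exact: (qorder_int K _ (l ^ j)%N).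
  by apply/ord0; exists (- n'), t'; rewrite intrN; ring.
by rewrite expnS natrM !intrM; ring.
Qed.

Lemma at_level_pow j ga : nilp j -> power_small j -> at_level j ga ->
  at_level j.+1 (ga ^+ l).
Proof.
move=> hj [z1 Oz1 z1E] [a [b [-> ha hb]]]; have [z2 Oz2 z2E] := nilp_sqr hj.
pose J := [set x | exists2 z, O 0 z & x = (l ^ j.+2)%:R * z].
have JD x y : J x -> J y -> J (x + y).
  move=> [x' Ox ->] [y' Oy ->]; exists (x' + y'); last by rewrite mulrDr.
  exact: ordD.
have JM x y : O 0 x -> J y -> J (x * y).
  by move=> Ox [y' Oy ->]; exists (x * y'); [exact: ordM|rewrite mulrCA].
have J0 : J 0 by exists 0; [exact: (qorder_int K _ 0)|rewrite mulr0].
pose x : K := b%:~R * ((l ^ j)%:R * th).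
have Oi := qorder_int K (c * l ^ 0).
have Ox : O 0 x by do !apply: ordM => //; apply: (Oi (l ^ j)%N).
have : J ((a%:~R + x) ^+ l - a%:~R ^+ l - l%:R * a%:~R ^+ l.-1 * x).
  rewrite binomial_tail ?prime_gt1 //; elim/big_ind: _ => // i _.
  rewrite -mulrnAr; apply: (JM); first exact: ordX.
  (* The last term x^l is controlled by [power_small]; in the others l divides the binomial
     coefficient and x^2 lies in l^(j + 1) O_0. *)
  have := ltn_ord i; rewrite -ltnS -[(_ < l.-1.+1)%N]ltnS prednK ?prime_gt0 //.
  rewrite ltnS leq_eqVlt => /predU1P[->|il].
    rewrite binn mulr1n exprMn z1E; apply: (JM); first exact: ordX.
    by exists z1.
  have /dvdnP[q ->] : (l %| 'C(l, i.+2))%N by apply: prime_dvd_bin.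
  rewrite -mulr_natl -addn2 exprD mulrA [x ^+ 2]exprMn z2E.
  exists (q%:R * x ^+ i * b%:~R ^+ 2 * z2); last by rewrite natrM (expnS _ j.+1) natrM; ring.
  by do !apply: ordM => //; try exact: ordX; exact: (Oi q).
move=> [z /ord0[p [q ->]] h].
exists (a ^+ l + (l ^ j.+2)%N%:Z * p), (a ^+ l.-1 * b + l%:Z * q); split.
- rewrite /repr_at; move/eqP: h; rewrite -addrA -opprD subr_eq => /eqP ->.
  by rewrite /x !(intrD, intrM) -!pmulrn !(natrX, rmorphXn) /= !exprS; ring.
- by rewrite intrD intrM expnS PoszM intrM Fl0 !mul0r addr0 rmorphXn expf_neq0.
- by rewrite intrD !intrM Fl0 !mul0r addr0 rmorphXn mulf_neq0 // expf_neq0.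
Qed.

Lemma level_sequence_pow s ga : nilp s ->
  (forall j, (s <= j)%N -> power_small j) -> at_level s ga -> level_sequence s ga.
Proof.
move=> hs hp hg j /subnK <-; elim: (j - s)%N => [|i IH].
  by rewrite add0n subnn expr1.
rewrite addSn subSn ?leq_addl // expnSr exprM.
by apply: at_level_pow => //; [apply: nilp_le hs _|apply: hp]; rewrite leq_addl.
Qed.

Lemma level_sequenceS s ga : at_level s ga -> level_sequence s.+1 (ga ^+ l) ->
  level_sequence s ga.
Proof.
move=> h0 h j; rewrite leq_eqVlt => /predU1P[<-|sj]; first by rewrite subnn expr1.
by have := h j sj; rewrite -exprM -expnS subnS prednK // subn_gt0.
Qed.

Lemma power_small_exp i j : (j.+2 <= i * l)%N -> (i <= j)%N -> power_small j.
Proof.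
move=> h ij; exists (((l ^ (j * l - j.+2)))%:R * th ^+ l).
  by apply: ordM; [exact: (qorder_int K _ (l ^ _)%N)|exact: ordX].
rewrite mulrA -natrM -expnD subnKC; first by rewrite exprMn -natrX -expnM.
by apply: leq_trans h _; rewrite leq_mul2r ij orbT.
Qed.

Lemma power_small_ge3 j : (3 <= l)%N -> (0 < j)%N -> power_small j.
Proof. by move=> l3 j0; apply: (@power_small_exp j) => //; nia. Qed.

(** The bound 2 j >= j + 2 needs j >= 2, whence the exponent d - 2 in (d). *)
Lemma power_small_2 j : l = 2%N -> (1 < j)%N -> power_small j.
Proof. by move=> l2 j1; apply: (@power_small_exp j) => //; rewrite l2; lia. Qed.

(** Here th^2 lies in 2 O_0, and this extra factor gives 2 j + 1 >= j + 2 already for j = 1. *)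
Lemma power_small_ramified2 j : l = 2%N -> nilp 0 -> (0 < j)%N -> power_small j.
Proof.
move=> l2 /nilp_sqr[z Oz]; rewrite !expn0 mul1r expn1 => thE j0.
exists ((l ^ (2 * j - j.+1))%:R * z).
  by apply: ordM => //; exact: (qorder_int K _ (l ^ _)%N).
rewrite mulrA -natrM -expnD exprMn -natrX {2}l2 -expnM.
rewrite (_ : th ^+ l = l%:R * z); last by rewrite {1}l2.
rewrite mulrA -natrM -expnSr; congr ((l ^ _)%:R * _).
by lia.
Qed.

(** Since th^2 lies in l O_0, the factor th^4 of th^l lies in l^2 O_0; the exponents 2 and 3 leave
    no room for it. *)
Lemma power_small_ramified5 : (5 <= l)%N -> nilp 0 -> power_small 0.
Proof.
move=> l5 /nilp_sqr[z Oz]; rewrite !expn0 !mul1r expn1 => thE.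
exists (z ^+ 2 * th ^+ (l - 4)); first by apply: ordM; apply: ordX.
rewrite expn0 mul1r.
have -> : th ^+ l = (th ^+ 2) ^+ 2 * th ^+ (l - 4).
  by rewrite -exprM -exprD; congr (_ ^+ _); lia.
by rewrite thE natrX; ring.
Qed.

End Levels.

(** * Generators of kappa_d *)

Section ZmodMaps.
Variable G : zmodType.

Definition mulmap m (g : G) (x : Zmod m) : G := g *+ x.

Lemma mulrn_mod (g : G) m k : g *+ m = 0 -> g *+ (k %% m) = g *+ k.
Proof.
by move=> h; rewrite {2}(divn_eq k m) mulrnDr mulnC mulrnA h mul0rn add0r.
Qed.

Lemma val_inZmod m k : (0 < m)%N -> (inZp k : Zmod m) = (k %% m)%N :> nat.
Proof. by case: m. Qed.

Lemma mulmap_additive m (g : G) : (0 < m)%N -> g *+ m = 0 ->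
  zmod_morphism (@mulmap m g).
Proof.
case: m => // m _ h x y; have hD : {morph @mulmap m.+1 g : u v / u + v}.
  by move=> u v; rewrite /mulmap /= mulrn_mod // mulrnDr.
by have := hD (x - y) y; rewrite subrK => ->; rewrite addrK.
Qed.
End ZmodMaps.

Lemma additive_of (A B : zmodType) (f : A -> B) : zmod_morphism f ->
  exists u : {additive A -> B}, forall x, u x = f x.
Proof.
move=> h; pose u : {additive A -> B} := HB.pack f (GRing.isZmodMorphism.Build A B f h).
by exists u.
Qed.

(* This can only fail when O_0 is the ring of Gaussian integers and [l = 2], or
   that of Eisenstein integers and [l = 3]. *)
Definition units_prime_to (K : fieldExtType rat) (c l : nat) : Prop :=
  forall x x' : K, qorder (c * l ^ 0) x -> qorder (c * l ^ 0) x' -> x * x' = 1 ->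
  exists r (m : int), coprime l r /\ x ^+ r = m%:~R.

Section Models.
Variables (K : fieldExtType rat) (hK : quadratic K) (c l : nat) (th : K) (t n : int).
Hypotheses (c_gt0 : (0 < c)%N) (l_pr : prime l) (gen : generates c th t n).
Hypothesis units : units_prime_to K c l.

Local Notation O d := (@qorder K (c * l ^ d)).
Local Notation U := (@coprime_elt K c l).
Local Notation nilp := (nilp l t n).
Local Notation lev := (at_level l th).
Local Notation phi := (local_class hK c_gt0 l_pr).
Local Notation kap := (kappa hK c_gt0 l_pr).
Implicit Types (i j k d s : nat) (al be ga eta : K).

Let hcop := generates_has_coprime l_pr gen.

Lemma at_level_in j al : lev j al -> O j al.
Proof. by case: gen => _ _ h [a [b [-> _ _]]]; apply/h; exists a, b. Qed.

(** A trivial class makes [al] a unit times an element of O_d. An exponent r prime to l turns the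
    unit into an integer and keeps the level. *)
Lemma level_torsion j d al : nilp j -> lev j al -> U al -> phi d al = 0 ->
  (d <= j)%N.
Proof.
move=> hj hal Ua /(local_class_eq0 Ua)[x [y [aE Oy Ox [x' Ox' xx']]]].
have [r [m [lr xr]]] := units Ox Ox' xx'.
apply: (at_level_ord l_pr gen (at_levelX l_pr gen hj hal lr)).
by rewrite aE exprMn xr; apply: ordM; [exact: qorder_int|exact: ordX].
Qed.

Lemma level_order s d k ga : nilp s -> level_sequence l th s ga -> U ga ->
  phi d ga *+ k = 0 -> (l ^ (d - s) %| k)%N.
Proof.
move=> hs hga Uga; case: (posnP k) => [-> //|k0].
(* With v the l-adic valuation of k, ga^k has level s + v: the exponent l^v raises the level from s,
   and the cofactor prime to l keeps it. *)
have [k' lk' kE] := pfactor_coprime l_pr k0.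
rewrite -(local_classX hcop _) // => /level_torsion h; rewrite kE dvdn_mull //.
apply: dvdn_exp2l; rewrite leq_subLR; apply: h; last exact: coprime_eltX.
  by apply: nilp_le hs _; rewrite leq_addr.
rewrite [X in ga ^+ X]kE mulnC exprM; apply: (at_levelX l_pr gen) => //.
  by apply: nilp_le hs _; rewrite leq_addr.
by have := hga (s + logn l k)%N (leq_addr _ _); rewrite addKn.
Qed.

Lemma level_order0 s d ga : (s <= d)%N -> level_sequence l th s ga -> U ga ->
  phi d ga *+ l ^ (d - s) = 0.
Proof.
move=> sd hga Uga; rewrite -(local_classX hcop _) // (local_class1 hcop) //.
  exact: coprime_eltX.
exact: at_level_in (hga d sd).
Qed.

(** The class of [al] is killed by some l^k, and q is invertible modulo l^k, so this class is a
    multiple of the class of al^q, which lies in O_s. *)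
Lemma kappa_onto s d (G : zmodType) (u : {additive G -> Cl hK c_gt0 l_pr d}) :
  (forall al, U al -> exists q, coprime l q /\ O s (al ^+ q)) ->
  (forall al, U al -> O s al -> exists g, u g = phi d al) ->
  forall C, kap d C -> exists g, u g = C.
Proof.
move=> red hu C /(kappaP hcop)[al [Ua -> [k hk]]].
have [q [lq Oq]] := red al Ua.
have [g hg] := hu _ (coprime_eltX l_pr q Ua) Oq.
have q0 : (0 < q)%N.
  by case: (q) lq => //; rewrite /coprime gcdn0 => /eqP l1; move: l_pr; rewrite l1.
have [a b ab _] := egcdnP (l ^ k) q0.
exists (g *+ a); rewrite raddfMn /= hg (local_classX hcop _) // -mulrnA (mulnC q a) ab.
have -> : gcdn q (l ^ k) = 1%N by apply/eqP; rewrite -/(coprime _ _) coprime_sym coprimeXl.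
by rewrite mulrnDr (mulnC b) mulrnA hk mul0rn add0r.
Qed.

Lemma kappa_cyclic s d m ga : m = (l ^ (d - s))%N -> (s <= d)%N -> nilp s ->
  level_sequence l th s ga -> U ga ->
  (forall al, U al -> exists q, coprime l q /\ O s (al ^+ q)) ->
  exists u : {additive Zmod m -> Cl hK c_gt0 l_pr d},
    (forall x, u x = phi d ga *+ x) /\ iso_onto u (kap d).
Proof.
move=> mE sd hs hga Uga red.
have m0 : (0 < m)%N by rewrite mE expn_gt0 prime_gt0.
have ga0 : phi d ga *+ m = 0 by rewrite mE; apply: level_order0.
have [u uE] : exists u : {additive Zmod m -> Cl hK c_gt0 l_pr d}, forall x, u x = phi d ga *+ x.
  exact: additive_of (mulmap_additive m0 ga0).
exists u; split=> //; split.
  apply: raddf_inj => x; rewrite uE => /(level_order hs hga Uga).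
  rewrite -mE => mx; apply/val_inj => /=; apply/eqP; rewrite eqn0Ngt.
  apply: contraL mx => x0; rewrite gtnNdvd //.
  by move: (ltn_ord x); rewrite [X in (_ < X)%N -> _]prednK.
apply/seteqP; split=> [_ [x _ <-]|C].
  rewrite uE -(local_classX hcop _) //; apply/(kappaP hcop).
  exists (ga ^+ x); split=> //; first exact: coprime_eltX.
  exists (d - s)%N; rewrite (local_classX hcop _) // mulrnAC -mE ga0.
  by rewrite mul0rn.
move=> /(kappa_onto red (u := u))[|x <-]; last by exists x.
move=> al Ua Oa; have ssd : (s <= s <= d)%N by rewrite leqnn.
have [k] := level_descent l_pr gen hs ssd hga Uga Ua Oa.
rewrite subnn mul1n => Ok; exists (- inZp k).
rewrite raddfN uE val_inZmod // mulrn_mod //.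
have Uk := coprime_eltX l_pr k Uga.
apply/eqP; rewrite eq_sym -addr_eq0 -(local_classX hcop _) // -(local_classM hcop) //.
by rewrite (local_class1 hcop) //; apply: coprime_eltM.
Qed.

(** Both groups are generated by classes of the same [ga], so that pi_d takes generator to
    generator. *)
Lemma kappa_model_cyclic s d m m' ga : m = (l ^ (d - s))%N ->
  m' = (l ^ (d.+1 - s))%N -> (s <= d)%N -> nilp s ->
  level_sequence l th s ga -> U ga ->
  (forall al, U al -> exists q, coprime l q /\ O s (al ^+ q)) ->
  @kappa_model K hK c l c_gt0 l_pr d (Zmod m) (Zmod m') (@can_Zmod m' m).
Proof.
move=> mE m'E sd hs hga Uga red.
have [u [uE hu]] := kappa_cyclic mE sd hs hga Uga red.
have [u' [u'E hu']] := kappa_cyclic m'E (leqW sd) hs hga Uga red.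
exists u, u'; split=> // x; rewrite u'E raddfMn /= (pi_local_class hcop) // uE.
rewrite val_inZmod ?mE ?expn_gt0 ?prime_gt0 // mulrn_mod //.
exact: level_order0.
Qed.

(** [h] accounts for the step from O_s to O_(s + 1) and [ga] for the rest. A relation with an
    exponent of [h] prime to l would give a trivial class to an element of level s < d. *)
Lemma kappa_split s d m ga h : m = (l ^ (d - s.+1))%N -> (s < d)%N -> nilp s ->
  level_sequence l th s.+1 ga -> U ga -> lev s h -> U h -> O d (h ^+ l) ->
  (forall al, U al -> exists q, coprime l q /\ O s (al ^+ q)) ->
  exists u : {additive Zmod m * Zmod l -> Cl hK c_gt0 l_pr d},
    (forall x, u x = phi d ga *+ x.1 + phi d h *+ x.2) /\ iso_onto u (kap d).
Proof.
move=> mE sd hs hga Uga hh Uh Ohl red.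
have m0 : (0 < m)%N by rewrite mE expn_gt0 prime_gt0.
have l0 := prime_gt0 l_pr.
have ga0 : phi d ga *+ m = 0 by rewrite mE; apply: level_order0.
have h0 : phi d h *+ l = 0.
  by rewrite -(local_classX hcop _) // (local_class1 hcop) //; apply: coprime_eltX.
have [u uE] : exists u : {additive Zmod m * Zmod l -> Cl hK c_gt0 l_pr d},
    forall x, u x = phi d ga *+ x.1 + phi d h *+ x.2.
  apply: additive_of => x y; have := mulmap_additive m0 ga0 x.1 y.1.
  have := mulmap_additive l0 h0 x.2 y.2; rewrite /mulmap => -> ->.
  by rewrite opprD addrACA.
exists u; split=> //; split.
  apply: raddf_inj => -[x y]; rewrite uE /= => xy0.
  have hg1 : O s.+1 ga.
    by have := at_level_in (hga _ (leqnn _)); rewrite subnn expr1.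
  have ly : (l %| y)%N.
    rewrite -[(_ %| _)%N]negbK -prime_coprime //; apply: contraTN sd => ly.
    rewrite -leqNgt; apply: (@level_torsion s d (h ^+ y * ga ^+ x)) => //.
    - apply: (at_levelMr l_pr gen) => //; first exact: (at_levelX l_pr gen).
        exact: coprime_eltX.
      exact: ordX.
    - by apply: coprime_eltM => //; apply: coprime_eltX.
    - rewrite (local_classM hcop) //; try exact: coprime_eltX.
      by rewrite !(local_classX hcop _) // addrC.
  have small N (z : Zmod N) : (0 < N)%N -> (N %| z)%N -> z = 0.
    move=> N0 Nz; apply/val_inj => /=; apply/eqP; rewrite eqn0Ngt.
    apply: contraL Nz => x0; rewrite gtnNdvd //.
    by move: (ltn_ord z); rewrite [X in (_ < X)%N -> _]prednK.
  have y0 := small _ y l0 ly; rewrite y0 mulr0n addr0 in xy0 *.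
  have := level_order (nilpS l t n s) hga Uga xy0.
  by rewrite -mE => /small ->.
apply/seteqP; split=> [_ [x _ <-]|C].
  rewrite uE -!(local_classX hcop _) // -(local_classM hcop) //; try exact: coprime_eltX.
  apply/(kappaP hcop); exists (ga ^+ x.1 * h ^+ x.2); split=> //.
    by apply: coprime_eltM => //; apply: coprime_eltX.
  exists (d - s.+1).+1; rewrite (local_classM hcop) //; try exact: coprime_eltX.
  rewrite !(local_classX hcop _) // mulrnDl [X in X + _]mulrnAC [X in _ + X]mulrnAC.
  by rewrite {1}expnSr expnS !mulrnA -mE ga0 h0 !mul0rn addr0.
move=> /(kappa_onto red (u := u))[|x <-]; last by exists x.
move=> al Ua Oa; have [k2 Ok2] := level_step l_pr gen hs hh Ua Oa.
have ssd : (s.+1 <= s.+1 <= d)%N by rewrite leqnn.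
have Uk2 := coprime_eltX l_pr k2 Uh.
have Ua2 := coprime_eltM l_pr Ua Uk2.
have [k] := level_descent l_pr gen (nilpS l t n s) ssd hga Uga Ua2 Ok2.
rewrite subnn mul1n => Ok; exists (- (inZp k, inZp k2)).
rewrite raddfN uE /fst /snd val_inZmod // val_inZmod // !mulrn_mod //.
have Uk := coprime_eltX l_pr k Uga.
apply/eqP; rewrite eq_sym -addr_eq0 -!(local_classX hcop _) //.
rewrite [phi _ (ga ^+ _) + _]addrC addrA -!(local_classM hcop) //.
by rewrite (local_class1 hcop) //; apply: coprime_eltM.
Qed.

(* [eta] is corrected by a power of [ga] so as to get an element of order [l]. *)
Lemma kappa_model_split s d m m' ga eta : m = (l ^ (d - s.+1))%N ->
  m' = (l ^ (d.+1 - s.+1))%N -> (s < d)%N -> nilp s ->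
  level_sequence l th s.+1 ga -> U ga -> lev s eta -> U eta ->
  O s.+2 (eta ^+ l) ->
  (forall al, U al -> exists q, coprime l q /\ O s (al ^+ q)) ->
  @kappa_model K hK c l c_gt0 l_pr d (Zmod m * Zmod l)%type (Zmod m' * Zmod l)%type
    (fun x => (@can_Zmod m' m x.1, x.2)).
Proof.
move=> mE m'E sd hs hga Uga heta Ueta Oeta red.
(* Descending to d + 1 and not only to d gives one corrected element whose l-th power is trivial at
   both stages; this makes the second component of pi_d the identity. *)
have [k Ok] : exists k, O d.+1 ((eta * ga ^+ k) ^+ l).
  have ssd : (s.+1 <= s.+2 <= d.+1)%N by rewrite leqnSn.
  have [k] := level_descent l_pr gen (nilpS l t n s) ssd hga Uga (coprime_eltX l_pr l Ueta) Oeta.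
  rewrite subSnn expn1 => hk; exists k.
  by rewrite exprMn -exprM [(k * l)%N]mulnC.
have hg1 : O s.+1 ga.
  by have := at_level_in (hga _ (leqnn _)); rewrite subnn expr1.
have Ugk := coprime_eltX l_pr k Uga.
have hh : lev s (eta * ga ^+ k).
  by apply: (at_levelMr l_pr gen) => //; apply: ordX.
have Uh := coprime_eltM l_pr Ueta Ugk.
have [u [uE hu]] := kappa_split mE sd hs hga Uga hh Uh (ord_le (leqnSn d) Ok) red.
have [u' [u'E hu']] := kappa_split m'E (leqW sd) hs hga Uga hh Uh Ok red.
exists u, u'; split=> // x; rewrite u'E raddfD !raddfMn /= !(pi_local_class hcop) // uE.
rewrite val_inZmod ?mE ?expn_gt0 ?prime_gt0 // mulrn_mod //.
exact: level_order0.
Qed.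

Lemma kappa1_eq0 :
  (forall al, U al -> exists q, coprime l q /\ O 1 (al ^+ q)) -> kap 1 = [set 0].
Proof.
move=> red; apply/seteqP; split=> [C|_ ->]; last first.
  by split; [exists 0%N; rewrite mul0rn|rewrite raddf0].
have [u uE] : exists u : {additive Zmod 1 -> Cl hK c_gt0 l_pr 1}, forall x, u x = 0.
  by apply: additive_of => x y; rewrite subr0.
move=> /(kappa_onto red (u := u))[|g <-]; last by rewrite uE.
by move=> al Ua Oa; exists 0; rewrite uE (local_class1 hcop).
Qed.

End Models.

(** * The discriminant *)

Section Trace.
Variables (K : fieldExtType rat) (hK : quadratic K).
Implicit Types (x y th : K) (a b t n : rat).

Let e := vbasis {:K}.
Let e_basis : basis_of {:K}%VS e := vbasisP {:K}.
Let M x := passmx.mxof e e (amulr x).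

Let mulM u x : u *m M x = passmx.rVof e (passmx.vecof e u * x).
Proof. by rewrite passmx.mul_mxof lfunE. Qed.

Let M_lin a x y : M (a *: x + y) = a *: M x + M y.
Proof.
apply/row_matrixP => i; rewrite !rowE mulmxDr -scalemxAr !mulM mulrDr -scalerAr.
exact: passmx.rVof_linear.
Qed.

Let M_1 : M 1 = 1%:M.
Proof.
apply/row_matrixP => i; rewrite !rowE mulM mulr1 mulmx1.
exact: passmx.vecofK.
Qed.

Let M_M x y : M (x * y) = M x *m M y.
Proof.
apply/row_matrixP => i; rewrite !rowE mulmxA !mulM mulrA.
by rewrite passmx.rVofK.
Qed.

Let M_Z a x : M (a *: x) = a *: M x.
Proof.
have M0 : M 0 = 0.
  have := M_lin 1 0 0; rewrite !scale1r addr0 => /eqP.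
  by rewrite -subr_eq0 opprD addNKr oppr_eq0 => /eqP.
by have := M_lin a x 0; rewrite M0 !addr0.
Qed.

Let M_irrat x a : x \notin 1%VS -> M x <> a%:M.
Proof.
move=> hx; rewrite -scalemx1 -M_1 -M_Z => h.
have := mulM (passmx.rVof e 1) x; rewrite h mulM.
move=> /(can_inj (passmx.rVofK e_basis)); rewrite passmx.rVofK // !mul1r => xE.
by move: hx; rewrite -xE memvZ ?memv_line.
Qed.

Lemma trace_linear a x y : trace (a *: x + y) = a * trace x + trace y.
Proof. by rewrite /trace -/e -!/(M _) M_lin linearP. Qed.

Lemma trace1 : trace (1 : K) = 2.
Proof. by rewrite /trace -/e -!/(M _) M_1 mxtrace1 hK. Qed.

(** Off the diagonal the relation reads A01 (A00 + A11) = t A01, and likewise for A10; when both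
    entries vanish, the difference of the diagonal relations has the factor A00 - A11. The three
    factors vanish together only for scalar A. *)
Lemma mxtrace_quadratic m (A : 'M[rat]_m) t n : m = 2 ->
  A *m A = t *: A - n%:M -> (forall a, A <> a%:M) -> \tr A = t.
Proof.
move=> m2; rewrite m2 in A *; move=> hA irr.
have E i j : A i 0 * A 0 j + A i 1 * A 1 j = t * A i j - n *+ (i == j).
  have := congr1 (fun B : 'M_2 => B i j) hA.
  rewrite !mxE big_ord_recl big_ord1.
  by have -> : lift ord0 ord0 = 1 :> 'I_2 by apply/val_inj.
have h00 := E 0 0; have h01 := E 0 1; have h10 := E 1 0; have h11 := E 1 1.
rewrite /= ?mulr0n ?mulr1n ?subr0 in h00 h01 h10 h11.
have -> : \tr A = A 0 0 + A 1 1.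
  rewrite /mxtrace big_ord_recl big_ord1.
  by have -> : lift ord0 ord0 = 1 :> 'I_2 by apply/val_inj.
have [a01|a01] := eqVneq (A 0 1) 0; last first.
  by apply: (mulfI a01); rewrite [RHS]mulrC -h01; ring.
have [a10|a10] := eqVneq (A 1 0) 0; last first.
  by apply: (mulfI a10); rewrite [RHS]mulrC -h10; ring.
have [a0|a0] := eqVneq (A 0 0 - A 1 1) 0; last first.
  apply/eqP; rewrite -subr_eq0; apply/eqP; apply: (mulfI a0); rewrite mulr0.
  rewrite a01 a10 !mulr0 ?addr0 ?add0r in h00 h11.
  transitivity (A 0 0 * A 0 0 - A 1 1 * A 1 1 - t * (A 0 0 - A 1 1)); first by ring.
  by rewrite h00 h11; ring.
case: (irr (A 1 1)); apply/matrixP => i j; rewrite !mxE.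
have ord2 (k : 'I_2) : k = 0 \/ k = 1.
  by case: k => [[|[|k]]] // hk; [left|right]; apply/val_inj.
case: (ord2 i) (ord2 j) => -> [] ->; rewrite ?a01 ?a10 ?mulr0n ?mulr1n //=.
by apply/eqP; rewrite -subr_eq0 a0.
Qed.

Lemma trace_quadratic th t n : th \notin 1%VS -> th ^+ 2 = t *: th - n%:A ->
  trace th = t.
Proof.
move=> hth h; apply: (mxtrace_quadratic (n := n) hK) => [|a]; last exact: M_irrat.
rewrite -!/(M _) -M_M -expr2 h -scaleNr addrC M_lin M_1 M_Z scaleNr scalemx1.
by rewrite addrC.
Qed.
End Trace.

Lemma det_mx2 (R : comNzRingType) (A : 'M[R]_2) :
  \det A = A 0 0 * A 1 1 - A 0 1 * A 1 0.
Proof.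
have o1 : lift ord0 ord0 = 1 :> 'I_2 by apply/val_inj.
have o0 : lift (1 : 'I_2) ord0 = 0 :> 'I_2 by apply/val_inj.
rewrite (expand_det_row _ 0) big_ord_recl big_ord1 o1 /cofactor !det_mx11 !mxE.
by rewrite !o1 !o0 /= expr0 expr1 mul1r mulN1r mulrN.
Qed.

Lemma generates_conductor (K : fieldExtType rat) (c : nat) (w : K) (t n : int) :
  (0 < c)%N -> generates 1 w t n ->
  generates c (c%:R * w) (c%:Z * t) (c%:Z ^+ 2 * n).
Proof.
move=> c0 [hw w2 hO]; split.
- apply: contra hw => h; have -> : w = (c%:R^-1 : rat) *: (c%:R * w).
    rewrite -(mulr_algl _ (c%:R * w)) -in_algE fmorphV rmorph_nat mulKf //.
    by rewrite -(rmorph_nat (in_alg K)) fmorph_eq0 pnatr_eq0 -lt0n.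
  exact: memvZ.
- by rewrite exprMn w2 !intrM; ring.
- move=> f x; have := hO (c * f)%N x; rewrite mul1n => ->.
  by split=> -[a [b ->]]; exists a, b; rewrite natrM; ring.
Qed.

Lemma generates_shift (K : fieldExtType rat) (c : nat) (w : K) (t n k : int) :
  generates c w t n ->
  generates c (w + k%:~R) (t + 2 * k) (n + t * k + k ^+ 2).
Proof.
move=> [hw w2 hO]; split.
- apply: contra hw => h; have -> : w = w + k%:~R - k%:~R by rewrite addrK.
  by rewrite rpredB // -int_alg memvZ ?memv_line.
- rewrite !(intrD, intrM); transitivity (w ^+ 2 + 2 * k%:~R * w + k%:~R ^+ 2); first by ring.
  by rewrite w2; ring.
- move=> f x; rewrite hO; split=> -[a [b ->]].
    by exists (a - b * f%:Z * k), b; rewrite !(intrD, intrM, intrN); ring.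
  by exists (a + b * f%:Z * k), b; rewrite !(intrD, intrM); ring.
Qed.

Lemma ringInt_gen (K : fieldExtType rat) (w : K) (t n : int) (x : K) :
  generates 1 w t n -> ringInt x <-> exists a b : int, x = a%:~R + b%:~R * w.
Proof.
move=> [_ _ hO]; have h := hO 1%N x; rewrite muln1 in h.
split=> [hx|[a [b xE]]].
  have [|a [b ->]] := h.1; last by exists a, b; rewrite mul1r.
  by exists 0, x; rewrite mul1r add0r.
by apply: (@qorder_sub _ 1); apply/h; exists a, b; rewrite mul1r.
Qed.

Lemma discriminant_generates (K : fieldExtType rat) (D : int) :
  quadratic K -> is_discriminant K D ->
  exists (w : K) (t n : int), generates 1 w t n /\ D = t ^+ 2 - 4 * n.
Proof.
move=> hK [e [e_basis hR hD]]; pose w0 := tnth e 0; pose w1 := tnth e 1.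
have o1 : lift ord0 ord0 = 1 :> 'I_2 by apply/val_inj.
have RE x : ringInt x <-> exists a b : int, x = a%:~R * w0 + b%:~R * w1.
  rewrite hR /=; split=> [[a ->]|[a [b ->]]].
    by exists (a 0), (a 1); rewrite big_ord_recl big_ord1 o1.
  exists (fun i => if i == 0 then a else b).
  by rewrite big_ord_recl big_ord1 o1.
have [|a [b one]] := (RE 1).1; first exact: (ringInt_int K 1).
(* 1 is a primitive vector of the lattice: for g = gcd(a, b), the rational 1 / g is integral, hence
   an integer. *)
have [u [v uv]] : exists u v, u * a + v * b = 1.
  have [u [v uv]] := Bezoutz a b; exists u, v; rewrite uv.
  pose g := gcdz a b; pose y := (a %/ g)%Z%:~R * w0 + (b %/ g)%Z%:~R * w1.
  have gy : g%:~R * y = 1.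
    rewrite /y mulrDr !mulrA -!intrM [g * _]mulrC divzK ?dvdz_gcdl //.
    by rewrite [g * _]mulrC divzK ?dvdz_gcdr.
  have g0 : g%:~R != 0 :> rat.
    rewrite intr_eq0; apply: contra_eq_neq gy => ->.
    by rewrite mul0r eq_sym oner_eq0.
  have yE : y = (g%:~R^-1 : rat)%:A.
    rewrite -in_algE fmorphV rmorph_int; apply: (mulfI (x := g%:~R)).
      by rewrite -(rmorph_int (in_alg K)) fmorph_eq0.
    by rewrite gy divff // -(rmorph_int (in_alg K)) fmorph_eq0.
  have [|q hq] := @ringInt_rat K g%:~R^-1.
    by rewrite -yE; apply/RE; exists (a %/ g)%Z, (b %/ g)%Z.
  have : g * q = 1.
    by apply: (@intr_inj rat); rewrite intrM -hq divff.
  move/(congr1 absz); rewrite abszM => /eqP; rewrite muln_eq1 => /andP[/eqP g1 _].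
  by rewrite -[LHS]/(Posz `|g|%N) g1.
(* The rows (a, b) and (-v, u) have determinant 1, so 1 and w form a Z-basis of the maximal
   order. *)
pose w := - v%:~R * w0 + u%:~R * w1.
have uvK : u%:~R * a%:~R + v%:~R * b%:~R = 1 :> K by rewrite -!intrM -intrD uv.
have oneM (k : int) : k%:~R = k%:~R * (a%:~R * w0 + b%:~R * w1) by rewrite -one mulr1.
have w0E : w0 = u%:~R - b%:~R * w.
  transitivity ((u%:~R * a%:~R + v%:~R * b%:~R) * w0); first by rewrite uvK mul1r.
  by rewrite [X in _ = X - _]oneM /w; ring.
have w1E : w1 = v%:~R + a%:~R * w.
  transitivity ((u%:~R * a%:~R + v%:~R * b%:~R) * w1); first by rewrite uvK mul1r.
  by rewrite [X in _ = X + _]oneM /w; ring.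
have RE' x : ringInt x <-> exists a b : int, x = a%:~R + b%:~R * w.
  rewrite RE; split=> -[p [q ->]].
    exists (p * u + q * v), (q * a - p * b); rewrite w0E w1E !(intrD, intrM, intrN).
    by rewrite /w; ring.
  exists (p * a - q * v), (p * b + q * u); rewrite !(intrD, intrM, intrN).
  by rewrite {1}(oneM p) /w; ring.
have w_irr : w \notin 1%VS.
  apply/negP => hw; have [x /negP[]] := ex_irrat hK.
  have: (<<e>> <= 1%VS)%VS.
    apply/span_subvP => y /tnthP[i ->]; case: (unliftP ord0 i) => [j|] ->.
      rewrite (ord1 j) o1 -/w1 w1E rpredD // -?int_alg ?memvZ ?memv_line //.
      by rewrite -scalerAl mul1r memvZ.
    rewrite -/w0 w0E rpredB // -?int_alg ?memvZ ?memv_line //.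
    by rewrite -scalerAl mul1r memvZ.
  by rewrite (span_basis e_basis) => /subvP; apply; apply: memvf.
have [|p [t w2]] := (RE' (w ^+ 2)).1.
  by rewrite expr2; apply: (submM (ringInt_subm K)); apply/RE'; exists 0, 1;
    rewrite mul1r add0r.
exists w, t, (- p); split.
  split=> //; first by rewrite w2 intrN opprK addrC.
  move=> f x; rewrite mul1n; split=> [[k [y [/RE'[q [r ->]] ->]]]|[q [r ->]]].
    by exists (k + f%:Z * q), r; rewrite intrD intrM; ring.
  exists q, (r%:~R * w); split; last by ring.
  by apply/RE'; exists 0, r; rewrite add0r.
have tr_w : trace w = t%:~R.
  apply: (trace_quadratic hK (n := - p%:~R) w_irr).
  by rewrite w2 scaleNr opprK int_alg -(mulr_algl _ w) int_alg addrC.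
have tr_lin (q r : int) : trace (q%:~R + r%:~R * w) = 2 * q%:~R + r%:~R * t%:~R.
  have -> : q%:~R + r%:~R * w = (r%:~R : rat) *: w + ((q%:~R : rat) *: 1 + 0).
    by rewrite addr0 -(mulr_algl _ w) !int_alg addrC.
  rewrite !trace_linear trace1 // tr_w.
  have -> : trace (0 : K) = 0.
    have := trace_linear (K := K) 1 0 0; rewrite scale1r addr0 mul1r => /eqP.
    by rewrite -subr_eq0 opprD addNKr oppr_eq0 => /eqP.
  by ring.
have tr_mul (q r q' r' : int) :
    trace ((q%:~R + r%:~R * w) * (q'%:~R + r'%:~R * w)) =
    2 * (q * q' + r * r' * p)%:~R + (q * r' + q' * r + r * r' * t)%:~R * t%:~R.
  rewrite -tr_lin; congr (trace _); rewrite !(intrD, intrM).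
  transitivity (q%:~R * q'%:~R + (q%:~R * r'%:~R + q'%:~R * r%:~R) * w
     + r%:~R * r'%:~R * w ^+ 2 : K); first by ring.
  by rewrite w2; ring.
apply: (@intr_inj rat); rewrite hD det_mx2 !mxE -/w0 -/w1.
have w0E' : w0 = u%:~R + (- b)%:~R * w by rewrite w0E intrN mulNr.
rewrite w0E' w1E !tr_mul.
(* The change of basis multiplies the discriminant by the square of its determinant u a + v b =
   1. *)
transitivity (((u * a + v * b) ^+ 2)%:~R * (t ^+ 2 - 4 * - p)%:~R : rat).
  by rewrite !(intrD, intrM, intrN); ring.
by rewrite uv expr1n mul1r.
Qed.

(** * Ramification and units *)

Lemma mulz_eq1_ge0 (u v : int) : 0 <= u -> u * v = 1 -> u = 1.
Proof.
case: u => // m _ /(congr1 absz); rewrite abszM => /eqP; rewrite muln_eq1.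
by move=> /andP[/eqP /= -> _].
Qed.

(** -k is the double root of X^2 - t X + n modulo l. For l = 2 the choice k = n works because n +
    n^2 and t are even; for odd l, k = t (l - 1) / 2 is -t / 2 modulo l. *)
Lemma dvd_disc_shift (l : nat) (t n : int) : prime l -> (l %| t ^+ 2 - 4 * n)%Z ->
  exists k : int, (l %| t + 2 * k)%Z /\ (l %| n + t * k + k ^+ 2)%Z.
Proof.
move=> l_pr; have [l2|/eqP l2] := eqVneq l 2%N.
  rewrite l2 => h; exists n; have /dvdzP[t' tE] : (2%N %| t)%Z.
    have : (2%N %| t * t)%Z by lia.
    by rewrite Euclid_dvdzM // orbb.
  split; first by lia.
  have [m [nE|nE]] : exists m, n = 2 * m \/ n = 2 * m + 1 by exists (n %/ 2)%Z; lia.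
    by apply/dvdzP; exists (m + t * m + 2 * m ^+ 2); rewrite nE; ring.
  by apply/dvdzP; exists (2 * m ^+ 2 + 3 * m + t' * n + 1); rewrite tE nE; ring.
have lodd : odd l by case: (even_prime l_pr).
have lE : l%:Z = 2 * (l./2)%:Z + 1 by have := odd_double_half l; rewrite lodd; lia.
move=> /dvdzP[q hq]; exists (t * (l./2)%:Z).
have lt : (l %| t + 2 * (t * (l./2)%:Z))%Z.
  by apply/dvdzP; exists t; rewrite lE; ring.
split=> //; set k := t * _ in lt *.
have : (l %| 4 * (n + t * k + k ^+ 2))%Z.
  have -> : 4 * (n + t * k + k ^+ 2) = (t + 2 * k) ^+ 2 - q * l by rewrite -hq; ring.
  by rewrite rpredB ?dvdz_mull // expr2 dvdz_mulr.
rewrite Euclid_dvdzM // => /orP[|//].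
by rewrite dvdzE /= (Euclid_dvdM 2 2) // orbb dvdn_prime2 // => /eqP.
Qed.

Section Ramification.
Variables (K : fieldExtType rat) (l : nat) (w : K) (t n : int).
Hypotheses (l_pr : prime l) (gen : generates 1 w t n).
Implicit Types (P Q : set K) (a b : int).

Let w_irr : w \notin 1%VS. Proof. by case: gen. Qed.
Let w2 : w ^+ 2 = t%:~R * w - n%:~R. Proof. by case: gen. Qed.
Let RE x := @ringInt_gen K w t n x gen.

Let coord_inj a b a' b' : a%:~R + b%:~R * w = a'%:~R + b'%:~R * w -> a = a' /\ b = b'.
Proof.
move=> h; have /(irrat_int w_irr)[/eqP + /eqP] : (a - a')%:~R + (b - b')%:~R * w = 0.
  by move/eqP: h; rewrite -subr_eq0 => /eqP <-; rewrite !intrB; ring.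
by rewrite !subr_eq0 => /eqP -> /eqP ->.
Qed.

Let scaleP x : idscale l%:R (@ringInt K) x <->
  exists a b, x = (l%:Z * a)%:~R + (l%:Z * b)%:~R * w.
Proof.
split=> [[y /RE[a [b ->]] <-]|[a [b ->]]]; first by exists a, b; rewrite !intrM; ring.
exists (a%:~R + b%:~R * w); first by apply/RE; exists a, b.
by rewrite !intrM; ring.
Qed.

Let scale_coord a b : idscale l%:R (@ringInt K) (a%:~R + b%:~R * w) ->
  (l %| a)%Z /\ (l %| b)%Z.
Proof. by move=> /scaleP[a' [b' /coord_inj[-> ->]]]; rewrite !dvdz_mulr. Qed.

Lemma ramified_dvd : ramified_in K l -> (l %| t ^+ 2 - 4 * n)%Z.
Proof.
move=> [P [hP sP _ _] lE].
(* If P were contained in l O_K, then l, an element of P^2, would lie in l^2 O_K. *)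
have [x Px nx] : exists2 x, P x & ~ idscale l%:R (@ringInt K) x.
  apply: contrapT => h; have sPl : P `<=` idscale l%:R (@ringInt K).
    by move=> x Px; apply: contrapT => nx; apply: h; exists x.
  have l2 : idmul P P `<=` idscale (l%:R * l%:R) (@ringInt K).
    apply: idmul_min => [|_ _ [x Rx <-] [y Ry <-]|x y /sPl[x' Rx <-] /sPl[y' Ry <-]].
    - by exists 0; [exact: subm0 (ringInt_subm K)|rewrite mulr0].
    - by exists (x + y); [exact: submD (ringInt_subm K) _ _|rewrite mulrDr].
    - by exists (x' * y'); [exact: submM (ringInt_subm K) _ _ _ _|ring].
  have : idmul P P (l%:R * 1) by rewrite -lE; exists 1 => //; apply: (ringInt_int K 1).
  move=> /l2[y /RE[a [b ->]]] h1.
  have : (l%:Z)%:~R + 0%:~R * w = (l%:Z * l%:Z * a)%:~R + (l%:Z * l%:Z * b)%:~R * w.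
    by rewrite mul0r addr0 -[LHS]mulr1 -h1 !intrM; ring.
  move=> /coord_inj[+ _]; rewrite -mulrA -[LHS]mulr1 => /mulfI hl.
  have : (l %| 1)%Z.
    by apply/dvdzP; exists a; rewrite mulrC; apply: hl; rewrite eqz_nat -lt0n prime_gt0.
  by rewrite dvdzE /= Euclid_dvd1.
have /RE[A [B xE]] := sP _ Px.
have [hA hB] : (l %| A ^+ 2 - n * B ^+ 2)%Z /\ (l %| 2 * A * B + t * B ^+ 2)%Z.
  apply: scale_coord; rewrite lE.
  have <- : x * x = (A ^+ 2 - n * B ^+ 2)%:~R + (2 * A * B + t * B ^+ 2)%:~R * w.
    rewrite xE !(intrD, intrM, intrN).
    transitivity (A%:~R * A%:~R + 2 * A%:~R * B%:~R * w
      + B%:~R * B%:~R * w ^+ 2 : K); first by ring.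
    by rewrite w2; ring.
  exact: idmul_in.
have lB : ~~ (l %| B)%Z.
  apply/negP => lB; apply: nx; rewrite xE.
  have /dvdzP[a aE] : (l %| A)%Z.
    have : (l %| A ^+ 2)%Z.
      by rewrite -[A ^+ 2](subrK (n * B ^+ 2)) rpredD // expr2 !dvdz_mull.
    by rewrite expr2 Euclid_dvdzM // orbb.
  move/dvdzP: lB => [b bE]; apply/scaleP; exists a, b.
  by rewrite aE bE ![_ * l%:Z]mulrC.
have l2 : (l %| 2 * A + t * B)%Z.
  have : (l %| B * (2 * A + t * B))%Z by rewrite (_ : _ * _ = 2 * A * B + t * B ^+ 2) //; ring.
  by rewrite Euclid_dvdzM // (negPf lB).
(* Modulo l, X^2 - t X + n has the double root -A / B, with B invertible. *)
have : (l %| (t ^+ 2 - 4 * n) * (B * B))%Z.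
  rewrite (_ : _ * _ = 4 * (A ^+ 2 - n * B ^+ 2) + 2 * t * (2 * A * B + t * B ^+ 2)
    - (2 * A + t * B) * (2 * A + t * B)); last by ring.
  by rewrite rpredB ?rpredD // dvdz_mull.
by rewrite !Euclid_dvdzM // (negPf lB) !orbF.
Qed.

(* When [l] divides the discriminant, [x = w + k] is nilpotent modulo [l] for
   some [k], hence belongs to every prime ideal above [l]. *)
Lemma unramified_ndvd : split_in K l \/ inert_in K l -> ~~ (l %| t ^+ 2 - 4 * n)%Z.
Proof.
move=> h; apply/negP => /(dvd_disc_shift l_pr)[k [lt ln]].
pose x := w + k%:~R.
have Rx : ringInt x by apply/RE; exists k, 1; rewrite mul1r addrC.
have x2 : idscale l%:R (@ringInt K) (x * x).
  move: lt ln => /dvdzP[t' tE] /dvdzP[n' nE].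
  exists (t'%:~R * x - n'%:~R).
    have RI := ringInt_int K; apply: (submB (ringInt_subm K)) => //.
    by apply: (submM (ringInt_subm K)).
  transitivity ((t' * l%:Z)%:~R * x - (n' * l%:Z)%:~R); first by rewrite !intrM; ring.
  rewrite -tE -nE /x !(intrD, intrM).
  transitivity ((t%:~R * w - n%:~R) + 2 * k%:~R * w + k%:~R * k%:~R); first by ring.
  by rewrite -w2; ring.
case: h => [[P [Q [hP hQ PQ lE]]]|hl]; last first.
  have : idscale l%:R (@ringInt K) x by case: (prime_mul hl Rx Rx x2).
  rewrite /x addrC -[w]mul1r => /(@scale_coord k 1)[_].
  by rewrite dvdzE /= Euclid_dvd1.
(* Modulo x every element is an integer, and a proper ideal containing l contains only the integers
   divisible by l; two prime ideals above l thus coincide. *)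
apply: PQ; have incl (I J : set K) : prime_ideal I -> prime_ideal J ->
    idscale l%:R (@ringInt K) `<=` I -> idscale l%:R (@ringInt K) `<=` J -> I `<=` J.
  move=> hI hJ sI sJ y Iy; have /RE[p [b yE]] := prime_sub hI Iy.
  pose a := p - b * k; have {}yE : y = a%:~R + b%:~R * x.
    by rewrite yE /a /x intrB intrM; ring.
  have Ix : I x by case: (prime_mul hI Rx Rx (sI _ x2)).
  have Jx : J x by case: (prime_mul hJ Rx Rx (sJ _ x2)).
  have mI := prime_submodule hI; have mJ := prime_submodule hJ.
  have Ia : I a%:~R.
    have -> : a%:~R = y - b%:~R * x by rewrite yE addrK.
    by apply: (submB mI) => //; apply: (submZ _ mI).
  have [/dvdzP[q aE]|la] := boolP (l %| a)%Z; last first.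
    have [u [v uv]] := prime_bezout 1 l_pr la; case: (prime_proper hI).
    have -> : 1 = u%:~R * a%:~R + l%:R * v%:~R :> K.
      by rewrite -[LHS]/(1%:~R) -uv expn1 intrD !intrM [_ * v%:~R]mulrC.
    apply: (submD mI); first exact: (submZ _ mI).
    by apply: sI; exists v%:~R => //; exact: ringInt_int.
  rewrite yE; apply: (submD mJ); last exact: (submZ _ mJ).
  apply: sJ; exists q%:~R; first exact: ringInt_int.
  by rewrite aE intrM mulrC.
have sP : idscale l%:R (@ringInt K) `<=` P.
  rewrite lE; apply: idmul_min; first exact: subm0 (prime_submodule hP).
    by move=> *; apply: (submD (prime_submodule hP)).
  by move=> u v Pu /(prime_sub hQ) Rv; rewrite mulrC; apply: (submM (prime_submodule hP)).
have sQ : idscale l%:R (@ringInt K) `<=` Q.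
  rewrite lE; apply: idmul_min; first exact: subm0 (prime_submodule hQ).
    by move=> *; apply: (submD (prime_submodule hQ)).
  by move=> u v /(prime_sub hP) Ru Qv; apply: (submM (prime_submodule hQ)).
by apply/seteqP; split; apply: incl.
Qed.

End Ramification.

(** If the discriminant were nonnegative, X^2 - t X + n would have a real root r, and a + b w -> a +
    b r would be a real embedding. *)
Lemma imaginary_disc (K : fieldExtType rat) (w : K) (t n : int) :
  quadratic K -> imaginary K -> generates 1 w t n -> t ^+ 2 - 4 * n < 0.
Proof.
move=> hK imK [w_irr w2 _]; rewrite ltNge; apply/negP => D0; apply: imK.
pose r : algC := (t%:~R + sqrtC (t ^+ 2 - 4 * n)%:~R) / 2.
have rR : r \is Num.real.
  rewrite /r rpredM ?rpredV ?realn // rpredD ?realz //.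
  by rewrite ger0_real // sqrtC_ge0 ler0z.
have r2 : r * r = t%:~R * r - n%:~R.
  have h := sqrtCK (t ^+ 2 - 4 * n)%:~R; set s := sqrtC _ in r rR h *.
  have -> : n%:~R = (t%:~R ^+ 2 - s ^+ 2) / 4 :> algC.
    by rewrite h !(intrD, intrM, intrN); field.
  by rewrite /r; field.
have coord x : {ab : rat * rat | x = ab.1%:A + ab.2 *: w}.
  by apply: cid; have [a [b h]] := quad_span x hK w_irr; exists (a, b).
pose f x : algC := ratr (sval (coord x)).1 + ratr (sval (coord x)).2 * r.
have fE (a b : rat) : f (a%:A + b *: w) = ratr a + ratr b * r.
  rewrite /f; case: (coord _) => -[a' b'] /= h.
  have [/eqP + /eqP] : a - a' = 0 /\ b - b' = 0.
    apply: (irrat w_irr); move/eqP: h; rewrite -subr_eq0 => /eqP <-.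
    by rewrite !scalerBl; ring.
  by rewrite !subr_eq0 => /eqP -> /eqP ->.
have fB : zmod_morphism f.
  move=> x y; have [[a b] -> /=] := coord x; have [[a' b'] -> /=] := coord y.
  have -> : a%:A + b *: w - (a'%:A + b' *: w) = (a - a')%:A + (b - b') *: w.
    by rewrite !scalerBl; ring.
  by rewrite !fE !rmorphB /=; ring.
have fM : monoid_morphism f.
  split.
    have -> : 1 = 1%:A + 0 *: w by rewrite scale1r scale0r addr0.
    by rewrite fE rmorph1 rmorph0 mul0r addr0.
  move=> x y; have [[a b] -> /=] := coord x; have [[a' b'] -> /=] := coord y.
  have -> : (a%:A + b *: w) * (a'%:A + b' *: w) =
      (a * a' - b * b' * n%:~R)%:A + (a * b' + a' * b + b * b' * t%:~R) *: w.
    rewrite -!(mulr_algl _ w) -!in_algE !(rmorphB, rmorphD, rmorphM, rmorph_int) /=.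
    transitivity (a%:A * a'%:A + (a%:A * b'%:A + a'%:A * b%:A) * w
      + b%:A * b'%:A * w ^+ 2); first by ring.
    by rewrite w2; ring.
  rewrite !fE !(rmorphB, rmorphD, rmorphM, rmorph_int, ratr_int) /=.
  transitivity (ratr a * ratr a' + (ratr a * ratr b' + ratr a' * ratr b) * r
      + ratr b * ratr b' * (r * r)); last by ring.
  by rewrite r2; ring.
pose s : {rmorphism K -> algC} := HB.pack f
  (GRing.isZmodMorphism.Build K algC f fB) (GRing.isMonoidMorphism.Build K algC f fM).
have Rq (q : rat) : (ratr q : algC) \is Num.real by apply: Creal_Crat; exact: Crat_rat.
by exists s => x; apply: rpredD => //; apply: rpredM.
Qed.

Lemma disc_mod4 (t n : int) : exists e : int,
  t ^+ 2 - 4 * n = 4 * e \/ t ^+ 2 - 4 * n = 4 * e + 1.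
Proof.
have [m [->|->]] : exists m, t = 2 * m \/ t = 2 * m + 1 by exists (t %/ 2)%Z; lia.
  by exists (m ^+ 2 - n); left; ring.
by exists (m ^+ 2 + m - n); right; ring.
Qed.

(** With T = 2 a + t b, the equation is four times the statement that a + b th has norm 1. As b^2 >=
    1, the discriminant is at least -4, and it is 0 or 1 modulo 4. *)
Lemma negative_disc_norm1 (t n T b : int) : b != 0 -> t ^+ 2 - 4 * n < 0 ->
  4 = T ^+ 2 - (t ^+ 2 - 4 * n) * b ^+ 2 ->
  t ^+ 2 - 4 * n = - 4 /\ T = 0 \/ t ^+ 2 - 4 * n = - 3 /\ T * T = 1.
Proof.
rewrite -sqrf_eq0 => b0; have b1 : 1 <= b ^+ 2 by rewrite -gtz0_ge1 lt0r b0 sqr_ge0.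
have [e] := disc_mod4 t n; move: (t ^+ 2 - _) => E hE E0 h; have T0 := sqr_ge0 T.
have E4 : - 4 <= E.
  have : E * b ^+ 2 <= E * 1 by rewrite ler_nM2l.
  by move: (E * b ^+ 2) h => x; lia.
have [E3|E3] : E = - 4 \/ E = - 3 by lia.
  left; split=> //; apply/eqP; rewrite -sqrf_eq0; apply/eqP; rewrite E3 in h; lia.
by right; split=> //; rewrite -expr2; rewrite E3 in h; lia.
Qed.

(** A unit x has norm 1 since the norm form is positive. With T its trace, x^2 = T x - 1 gives x^2 =
    -1 when T = 0 and x^3 = -T when T^2 = 1. *)
Lemma units_of_disc (K : fieldExtType rat) (c l : nat) (th : K) (t n : int) :
  prime l -> generates c th t n -> t ^+ 2 - 4 * n < 0 ->
  (t ^+ 2 - 4 * n = - 3 -> l <> 3%N) -> (t ^+ 2 - 4 * n = - 4 -> l <> 2%N) ->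
  units_prime_to K c l.
Proof.
move=> l_pr gen D0 h3 h4 x x'; have [th_irr th2 hO] := gen; rewrite expn0.
move=> /hO[a [b xE]] /hO[a' [b' x'E]] xx'; rewrite !mul1r in xE x'E.
pose N a b := a ^+ 2 + t * a * b + n * b ^+ 2.
have N1 : N a b * N a' b' = 1.
  pose P := a * a' - n * b * b'; pose Q := a * b' + a' * b + t * b * b'.
  have /(irrat_int th_irr)[/eqP + Q0] : (P - 1)%:~R + Q%:~R * th = 0.
    have -> : (P - 1)%:~R + Q%:~R * th = P%:~R + Q%:~R * th - x * x'.
      by rewrite xx' intrB; ring.
    rewrite xE x'E /P /Q !(intrD, intrN, intrM).
    transitivity (b%:~R * b'%:~R * (t%:~R * th - n%:~R - th ^+ 2)); first by ring.
    by rewrite th2 subrr mulr0.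
  rewrite subr_eq0 => /eqP P1.
  transitivity (P ^+ 2 + t * P * Q + n * Q ^+ 2); first by rewrite /N /P /Q; ring.
  by rewrite P1 Q0; ring.
have N4 : 4 * N a b = (2 * a + t * b) ^+ 2 - (t ^+ 2 - 4 * n) * b ^+ 2 by rewrite /N; ring.
have {}N1 : N a b = 1.
  apply: mulz_eq1_ge0 N1; rewrite -(@pmulr_rge0 _ 4) // N4 subr_ge0.
  by apply: le_trans (sqr_ge0 _); rewrite nmulr_rle0 // sqr_ge0.
have x2 : x ^+ 2 = (2 * a + t * b)%:~R * x - 1.
  transitivity ((2 * a + t * b)%:~R * x - (N a b)%:~R); last by rewrite N1.
  rewrite xE /N !(intrD, intrM).
  transitivity (a%:~R * a%:~R + 2 * a%:~R * b%:~R * th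
    + b%:~R * b%:~R * th ^+ 2 : K); first by ring.
  by rewrite th2; ring.
rewrite N1 mulr1 in N4.
have [b0|b0] := eqVneq b 0.
  by exists 1%N, a; rewrite coprimen1 xE b0 mul0r addr0 expr1.
set T := 2 * a + t * b in x2 N4.
have [[E T0]|[E T1]] := negative_disc_norm1 b0 D0 N4.
  exists 2%N, (-1); rewrite x2 T0 mul0r sub0r intrN; split=> //.
  by rewrite prime_coprime // dvdn_prime2 //; apply/eqP; exact: h4.
exists 3%N, (- T); split.
  by rewrite prime_coprime // dvdn_prime2 //; apply/eqP; exact: h3.
rewrite exprS x2; transitivity (T%:~R * x ^+ 2 - x : K); first by ring.
rewrite x2; transitivity ((T * T)%:~R * x - x - T%:~R : K); first by rewrite intrM; ring.
by rewrite T1 mul1r subrr sub0r intrN.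
Qed.

(** * Reduction to level one at unramified primes *)

Lemma freshman (R : comNzRingType) (l : nat) (x y : R) : prime l ->
  (x + y) ^+ l - x ^+ l - y ^+ l =
  l%:R * \sum_(i < l.-1) ('C(l, i.+1) %/ l)%:R * (x ^+ (l - i.+1) * y ^+ i.+1).
Proof.
move=> l_pr; rewrite exprDn mulr_sumr.
transitivity (\sum_(i < l.-1) x ^+ (l - i.+1) * y ^+ i.+1 *+ 'C(l, i.+1)).
  case: l l_pr => // m _; rewrite big_ord_recl big_ord_recr /= subn0 subnn.
  rewrite bin0 binn !expr0 mulr1 mul1r !mulr1n.
  by rewrite [x ^+ _ + _]addrC addrK addrK.
apply: eq_bigr => i _; rewrite [RHS]mulrA -natrM mulnC divnK ?mulr_natl //.
by apply: prime_dvd_bin => //=; have := ltn_ord i; have := prime_gt0 l_pr; lia.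
Qed.

Section Reduction.
Variables (K : fieldExtType rat) (c l : nat) (th : K) (t n : int).
Hypotheses (l_pr : prime l) (gen : generates c th t n).

Local Notation O d := (@qorder K (c * l ^ d)).
Local Notation U := (@coprime_elt K c l).
Implicit Types (x y z al : K) (a b : int).

Let th2 : th ^+ 2 = t%:~R * th - n%:~R. Proof. by case: gen. Qed.

Let ord0 x : O 0 x <-> exists a b : int, x = a%:~R + b%:~R * th.
Proof.
case: gen => _ _ ->; rewrite expn0.
by split=> -[a [b ->]]; exists a, b; rewrite mul1r.
Qed.

Let ord_th : O 0 th.
Proof. by apply/ord0; exists 0, 1; rewrite add0r mul1r. Qed.

Definition congr_mod x y : Prop := exists2 z, O 0 z & x - y = l%:R * z.

Lemma congr_mod_trans x y z : congr_mod x y -> congr_mod y z -> congr_mod x z.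
Proof.
move=> [u Ou xy] [v Ov yz]; exists (u + v); first exact: ordD.
by rewrite mulrDr -xy -yz; ring.
Qed.

Lemma congr_modD x y x' y' : congr_mod x y -> congr_mod x' y' ->
  congr_mod (x + x') (y + y').
Proof.
move=> [u Ou xy] [v Ov yz]; exists (u + v); first exact: ordD.
by rewrite mulrDr -xy -yz; ring.
Qed.

Lemma congr_modM z x y : O 0 z -> congr_mod x y -> congr_mod (z * x) (z * y).
Proof.
by move=> Oz [u Ou xy]; exists (z * u); [exact: ordM|rewrite mulrCA -xy mulrBr].
Qed.

Lemma congr_modX k x y : O 0 x -> O 0 y -> congr_mod x y -> congr_mod (x ^+ k) (y ^+ k).
Proof.
move=> Ox Oy xy; elim: k => [|k IH].
  by exists 0; [exact: (qorder_int K _ 0)|rewrite subrr mulr0].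
rewrite !exprS; apply: congr_mod_trans (congr_modM Oy IH).
by rewrite ![_ * x ^+ k]mulrC; apply: congr_modM => //; apply: ordX.
Qed.

Lemma congr_mod_int a b : (l %| a - b)%Z -> congr_mod a%:~R b%:~R.
Proof.
move=> /dvdzP[q h]; exists q%:~R; first exact: qorder_int.
by rewrite -intrB h intrM mulrC.
Qed.

Lemma fermat_int a : (l %| a ^+ l - a)%Z.
Proof.
rewrite -Fp_int_eq0 // intrB rmorphXn /= subr_eq0; apply/eqP.
by have := expf_card (a%:~R : 'F_l); rewrite card_Fp.
Qed.

Lemma congr_mod_refl x : congr_mod x x.
Proof. by exists 0; [exact: (qorder_int K _ 0)|rewrite subrr mulr0]. Qed.

Lemma frobenius_mod a b y : O 0 y ->
  congr_mod ((a%:~R + b%:~R * y) ^+ l) (a%:~R + b%:~R * y ^+ l).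
Proof.
move=> Oy; have Oi := qorder_int K (c * l ^ 0).
apply: (congr_mod_trans (y := a%:~R ^+ l + (b%:~R * y) ^+ l)).
  have h := freshman a%:~R (b%:~R * y) l_pr; move: h.
  set S := \sum_(i < _) _ => h; exists S; last by rewrite opprD addrA h.
  rewrite /S; elim/big_ind: _ => [|u v|i _]; [exact: (Oi 0)|exact: ordD|].
  apply: ordM; first exact: (Oi ('C(l, i.+1) %/ l)%N).
  by apply: ordM; apply: ordX; [exact: Oi|exact: ordM].
rewrite exprMn; apply: congr_modD.
  by rewrite -rmorphXn; apply: congr_mod_int; apply: fermat_int.
rewrite ![_ * y ^+ l]mulrC; apply: congr_modM; first exact: ordX.
by rewrite -rmorphXn; apply: congr_mod_int; apply: fermat_int.
Qed.

(* [O_0 / l O_0] is the product of two copies of F_l or the field with l^2 elements. *)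
Lemma th_frobenius2 :
  l = 2%N /\ ~~ (l %| t)%Z \/ [/\ odd l, (l %| t)%Z & ~~ (l %| n)%Z] ->
  congr_mod (th ^+ (l * l)) th.
Proof.
have Oi := qorder_int K (c * l ^ 0).
case=> [[l2 lt]|[lodd lt ln]].
  have thE : th ^+ (l * l) = (t ^+ 3 - 2 * t * n)%:~R * th + (n ^+ 2 - t ^+ 2 * n)%:~R.
    rewrite l2 (exprM th 2 2) th2 !(intrD, intrM, intrN).
    transitivity (t%:~R * t%:~R * th ^+ 2 - 2 * t%:~R * n%:~R * th + n%:~R * n%:~R : K).
      by ring.
    by rewrite th2; ring.
  rewrite thE -[th in X in congr_mod _ X]mul1r -[X in congr_mod _ X]addr0.
  rewrite l2 in lt.
  have [m tE] : exists m, t = 2 * m + 1 by exists (t %/ 2)%Z; lia.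
  have [k nE] : exists k, n ^+ 2 - n = 2 * k.
    have [k [->|->]] : exists k, n = 2 * k \/ n = 2 * k + 1 by exists (n %/ 2)%Z; lia.
      by exists (2 * k ^+ 2 - k); ring.
    by exists (2 * k ^+ 2 + k); ring.
  apply: congr_modD; rewrite ?[_ * th]mulrC; first apply: congr_modM => //.
    apply: (@congr_mod_int _ 1); rewrite l2; apply/dvdzP.
    by exists (4 * m ^+ 3 + 6 * m ^+ 2 + 3 * m - t * n); rewrite tE; ring.
  apply: (@congr_mod_int _ 0); rewrite l2; apply/dvdzP.
  exists (k - (2 * m ^+ 2 + 2 * m) * n); rewrite subr0.
  transitivity (n ^+ 2 - n - (t ^+ 2 - 1) * n); first by ring.
  by rewrite nE tE; ring.
have thn : congr_mod (th ^+ 2) (- n)%:~R.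
  rewrite th2 intrN -[X in congr_mod _ X]add0r; apply: congr_modD (congr_mod_refl _).
  have [q ->] := dvdzP lt; exists (q%:~R * th); first exact: ordM.
  by rewrite intrM; ring.
(* Here l./2 + 1 is (l + 1) / 2, so th^(l^2) is th times the power (l - 1) (l + 1) / 2 of th^2; as
   th^2 is -n modulo l, Fermat applies to -n. *)
have lE : (l * l = (2 * ((l - 1) * (l./2).+1)).+1)%N.
  have lk : l = (l./2).*2.+1 by rewrite -[LHS]odd_double_half lodd.
  by move: (l./2) lk => k ->; rewrite subn1 /= -muln2; nia.
rewrite lE exprS -[X in congr_mod _ X]mulr1; apply: congr_modM => //.
rewrite exprM; apply: congr_mod_trans (congr_modX _ _ _ thn) _; [exact: ordX|exact: Oi|].
rewrite -rmorphXn; apply: (@congr_mod_int _ 1).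
rewrite -Fp_int_eq0 // intrB rmorphXn /= exprM.
have n0 : (- n)%:~R != 0 :> 'F_l by rewrite Fp_int_eq0 // dvdzE abszN -dvdzE.
have -> : (- n)%:~R ^+ (l - 1) = 1 :> 'F_l.
  apply: (mulfI n0); rewrite -exprS subn1 prednK ?prime_gt0 // mulr1.
  by have := expf_card ((- n)%:~R : 'F_l); rewrite card_Fp.
by rewrite expr1n subrr.
Qed.

(** The exponent l^2 - 1 kills the units of O_0 / l O_0, whether l is split or inert, and what is 1
    modulo l lies in O_1. Multiplying by [be] and cancelling m replaces division by [al]. *)
Lemma unramified_reduction :
  l = 2%N /\ ~~ (l %| t)%Z \/ [/\ odd l, (l %| t)%Z & ~~ (l %| n)%Z] ->
  forall al, U al -> exists q, coprime l q /\ O 1 (al ^+ q).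
Proof.
move=> /th_frobenius2 hth al Ua; have [Oa [be [m [Ob lm am]]]] := Ua.
have l0 := prime_gt0 l_pr; exists (l * l - 1)%N; split.
  rewrite prime_coprime //; apply/negP => h.
  have : (l %| l * l - (l * l - 1))%N by rewrite dvdn_sub // dvdn_mull.
  by rewrite subKn ?muln_gt0 ?l0 // Euclid_dvd1.
have hal : congr_mod (al ^+ (l * l)) al.
  have [a [b ->]] := (ord0 al).1 Oa; rewrite exprM.
  have Oi := qorder_int K (c * l ^ 0).
  have Oy : O 0 (a%:~R + b%:~R * th) by apply/ord0; exists a, b.
  have Oyl : O 0 (a%:~R + b%:~R * th ^+ l).
    by apply: ordD => //; apply: ordM => //; apply: ordX.
  apply: congr_mod_trans (congr_modX l (ordX _ Oy) Oyl (frobenius_mod a b ord_th)) _.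
  apply: congr_mod_trans (frobenius_mod a b (ordX _ ord_th)) _.
  by rewrite -exprM; apply: congr_modD (congr_mod_refl _) (congr_modM _ hth).
have [z Oz hz] : congr_mod (m%:~R * al ^+ (l * l - 1)) m%:~R.
  have -> : m%:~R * al ^+ (l * l - 1) = be * al ^+ (l * l).
    by rewrite -am mulrAC -exprS subn1 prednK ?muln_gt0 ?l0 // mulrC.
  by rewrite -am [al * be]mulrC; apply: congr_modM.
rewrite -[al ^+ _](subrK 1); apply: ordD; last exact: qorder1.
apply: (coprime_cancel l_pr (k := 1) (qorder_subm K _) lm).
  by rewrite mulrBr mulr1 hz -[l in l%:R]expn1; apply: ord_conductor.
apply: ord_conductor; apply: ordB; last exact: qorder1.
exact: ordX.
Qed.

End Reduction.

(** * The four cases *)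

(** Translating [th] completes the square modulo l, except for l = 2 unramified, where t is odd as
    it stands. *)
Lemma generates_normal (K : fieldExtType rat) (c l : nat) (th : K) (t n : int) :
  prime l -> generates c th t n ->
  exists (th' : K) (t' n' : int),
    [/\ generates c th' t' n', t' ^+ 2 - 4 * n' = t ^+ 2 - 4 * n,
        (l %| t ^+ 2 - 4 * n)%Z -> (l %| t')%Z /\ (l %| n')%Z
      & ~~ (l %| t ^+ 2 - 4 * n)%Z ->
        l = 2%N /\ ~~ (l %| t')%Z \/ [/\ odd l, (l %| t')%Z & ~~ (l %| n')%Z]].
Proof.
move=> l_pr gen; have [lE|lE] := boolP (l %| t ^+ 2 - 4 * n)%Z.
  have [k [lt ln]] := dvd_disc_shift l_pr lE.
  exists (th + k%:~R), (t + 2 * k), (n + t * k + k ^+ 2).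
  by split=> //; [exact: generates_shift|ring].
have [l2|/eqP l2] := eqVneq l 2%N.
  exists th, t, n; split=> // _; left; split=> //.
  rewrite l2 in lE *; apply: contra lE => /dvdzP[q ->].
  by apply/dvdzP; exists (2 * q ^+ 2 - 2 * n); ring.
have lodd : odd l by case: (even_prime l_pr).
pose k := t * (l./2)%:Z.
have lt : (l %| t + 2 * k)%Z.
  apply/dvdzP; exists t; have := odd_double_half l; rewrite lodd /k => lk.
  by transitivity (t * (1 + l./2.*2)%N%:Z); [rewrite -muln2; lia|rewrite lk].
exists (th + k%:~R), (t + 2 * k), (n + t * k + k ^+ 2).
have EE : (t + 2 * k) ^+ 2 - 4 * (n + t * k + k ^+ 2) = t ^+ 2 - 4 * n by ring.
split=> //; first exact: generates_shift.
move=> _; right; split=> //; apply: contra lE => ln.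
by rewrite -EE rpredB ?dvdz_mull // expr2 dvdz_mulr.
Qed.

Section Cases.
Variables (K : fieldExtType rat) (hK : quadratic K) (c l : nat) (th : K) (t n : int).
Hypotheses (c_gt0 : (0 < c)%N) (l_pr : prime l) (gen : generates c th t n).
Hypothesis units : units_prime_to K c l.

Local Notation O d := (@qorder K (c * l ^ d)).
Local Notation U := (@coprime_elt K c l).
Local Notation lev := (at_level l th).
Implicit Types (d j : nat) (al : K).

Let th2 : th ^+ 2 = t%:~R * th - n%:~R. Proof. by case: gen. Qed.

Lemma at_level_one_add j : lev j (1 + (l ^ j)%:R * th).
Proof. by exists 1, 1; split; rewrite /repr_at ?mul1r ?oner_eq0. Qed.

(** Modulo l, the norm of a + b l^j th is a^2. *)
Lemma at_level_coprime j al : nilp l t n j -> lev j al -> U al.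
Proof.
move=> hj [a [b [-> ha _]]];
have -> : b%:~R * ((l ^ j)%:R * th) = (b * (l ^ j)%N%:Z)%:~R * th by rewrite intrM mulrA.
apply: (coprime_elt_norm gen); rewrite -Fp_int_eq0 //.
have [lt ln] : (t * (l ^ j)%N%:Z)%:~R = 0 :> 'F_l /\ (n * (l ^ j)%N%:Z)%:~R = 0 :> 'F_l.
  case: hj => [|[lt ln]]; last first.
    by rewrite !intrM; move: lt ln; rewrite -!Fp_int_eq0 // => /eqP -> /eqP ->; rewrite !mul0r.
  by case: (j) => // i _; rewrite expnS PoszM !intrM Fl0 // !(mul0r, mulr0).
have -> : a ^+ 2 + t * a * (b * (l ^ j)%N) + n * (b * (l ^ j)%N) ^+ 2 =
   a ^+ 2 + a * b * (t * (l ^ j)%N) + b * (b * (l ^ j)%N) * (n * (l ^ j)%N).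
  by ring.
rewrite !intrD [(_ * (t * _))%:~R]intrM [(_ * (n * _))%:~R]intrM lt ln.
by rewrite !mulr0 !addr0 rmorphXn expf_neq0.
Qed.

Lemma kappa_model_unramified_odd d : (3 <= l)%N -> (0 < d)%N -> (l %| t)%Z -> ~~ (l %| n)%Z ->
  @kappa_model K hK c l c_gt0 l_pr d (Zmod (l ^ (d - 1))) (Zmod (l ^ d)) (@can_Zmod _ _).
Proof.
move=> l3 d0 lt ln; have lev1 := at_level_one_add 1.
have nil1 : nilp l t n 1 by left.
apply: (kappa_model_cyclic hK c_gt0 l_pr gen units _ _ d0 nil1 _
  (at_level_coprime nil1 lev1)) => //.
- by rewrite subn1.
- by apply: (level_sequence_pow l_pr gen nil1) => // j; apply: (power_small_ge3 l_pr gen).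
- apply: (unramified_reduction l_pr gen); right; split=> //.
  by case: (even_prime l_pr) l3 => [->|].
Qed.

Lemma trivial_reduction al : U al -> exists q, coprime l q /\ O 0 (al ^+ q).
Proof. by move=> [Oa _]; exists 1%N; rewrite coprimen1 expr1. Qed.

Lemma one_add_sqr : (1 + th) ^+ 2 = (1 - n)%:~R + (2 + t)%:~R * th.
Proof.
rewrite intrB intrD; transitivity (1 + 2 * th + th ^+ 2); first by ring.
by rewrite th2; ring.
Qed.

Lemma one_add_cube : (1 + th) ^+ 3 =
  (1 - 3 * n - t * n)%:~R + (3 + 3 * t + t ^+ 2 - n)%:~R * th.
Proof.
rewrite exprS one_add_sqr !(intrB, intrD, intrM).
transitivity (1 - n%:~R + (2 + t%:~R + 1 - n%:~R) * th + (2 + t%:~R) * th ^+ 2); first by ring.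
by rewrite th2; ring.
Qed.

Lemma kappa_model_ramified_cyclic d : nilp l t n 0 ->
  [\/ l = 2%N /\ exists k, t ^+ 2 - 4 * n = 16 * k + 8,
      l = 3%N /\ exists k, t ^+ 2 - 4 * n = 9 * k + 3 | (5 <= l)%N] ->
  @kappa_model K hK c l c_gt0 l_pr d (Zmod (l ^ d)) (Zmod (l ^ d.+1)) (@can_Zmod _ _).
Proof.
move=> nil0 hl; have := at_level_one_add 0; rewrite expn0 mul1r => lev0.
have U0 := at_level_coprime nil0 lev0.
apply: (kappa_model_cyclic hK c_gt0 l_pr gen units _ _ (leq0n d) nil0 _ U0) => //; rewrite ?subn0 //.
  have [lt ln] : (l %| t)%Z /\ (l %| n)%Z by case: nil0.
  have nil1 : nilp l t n 1 by left.
  case: hl => [[l2 [k E]]|[l3 [k E]]|l5].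
  - apply: (level_sequenceS lev0); apply: (level_sequence_pow l_pr gen nil1).
      by move=> j; apply: (power_small_ramified2 l_pr gen).
    rewrite l2 in lt ln; move: lt ln => /dvdzP[t' tE] /dvdzP[n' nE].
    (* The discriminant is 4 t'^2 - 8 n', and the residue 8 modulo 16 makes t' even, so 1 + t' is
       odd. *)
    have [k' k'E] : exists k', t' = 2 * k'.
      have : (2%N %| t' * t')%Z.
        by apply/dvdzP; exists (2 * k + 1 + n'); move: E; rewrite tE nE; nia.
      by rewrite (Euclid_dvdzM (l := 2)) // orbb => /dvdzP[k' ->]; exists k'; rewrite mulrC.
    exists (1 - n), (1 + t'); split.
    + by rewrite /repr_at l2 one_add_sqr expn1 tE !(intrD, intrM); ring.
    + by rewrite Fp_int_eq0 // l2 nE; lia.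
    + by rewrite Fp_int_eq0 // l2 k'E; lia.
  - apply: (level_sequenceS lev0); apply: (level_sequence_pow l_pr gen nil1).
      by move=> j; apply: (power_small_ge3 l_pr gen) => //; rewrite l3.
    rewrite l3 in lt ln; move: lt ln => /dvdzP[t' tE] /dvdzP[n' nE].
    (* The discriminant is -3 n' modulo 9, so the residue 3 means n' = 2 modulo 3, and the
       coefficient 1 - n' along 3 th is prime to 3. *)
    exists (1 - 3 * n - t * n), (1 + t + t' * t - n'); split.
    + rewrite /repr_at l3 one_add_cube expn1 tE nE !(intrD, intrM, intrN); ring.
    + by rewrite Fp_int_eq0 // l3 nE tE; lia.
    + rewrite Fp_int_eq0 // l3; move: E; rewrite tE nE; move: (t' ^+ 2) => *; lia.
  - apply: (level_sequence_pow l_pr gen nil0) => // -[|j] _.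
      exact: (power_small_ramified5 l_pr gen).
    by apply: (power_small_ge3 l_pr gen) => //; lia.
exact: trivial_reduction.
Qed.

Lemma kappa_model_ramified_split d : nilp l t n 0 -> (0 < d)%N ->
  (l = 2%N /\ exists k, t ^+ 2 - 4 * n = 16 * k + 12) \/
  (l = 3%N /\ exists k, t ^+ 2 - 4 * n = 9 * k + 6) ->
  @kappa_model K hK c l c_gt0 l_pr d (Zmod (l ^ (d - 1)) * Zmod l)%type (Zmod (l ^ d) * Zmod l)%type
    (fun x => (@can_Zmod _ _ x.1, x.2)).
Proof.
move=> nil0 d0 hl; have := at_level_one_add 0; rewrite expn0 mul1r => lev0.
have U0 := at_level_coprime nil0 lev0.
have lev1 := at_level_one_add 1; have nil1 : nilp l t n 1 by left.
have U1 := at_level_coprime nil1 lev1.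
have [lt ln] : (l %| t)%Z /\ (l %| n)%Z by case: nil0.
apply: (kappa_model_split hK c_gt0 l_pr gen units _ _ d0 nil0 _ U1 lev0 U0) => //.
- by rewrite subn1.
- apply: (level_sequence_pow l_pr gen nil1) => // j; case: hl => -[l23 _].
    exact: (power_small_ramified2 l_pr gen).
  by apply: (power_small_ge3 l_pr gen) => //; rewrite l23.
- case: gen => _ _ ->; case: hl => -[l23 [k E]]; rewrite l23 in lt ln *;
    move: lt ln => /dvdzP[t' tE] /dvdzP[n' nE].
    (* The residue 12 modulo 16 makes t' odd, hence 4 divides 2 + t and (1 + th)^2 lies in O_2. *)
    have [k' k'E] : exists k', t' = 2 * k' + 1.
      have : ~~ (2%N %| t' * t')%Z.
        by apply/negP => /dvdzP[q qE]; move: E; rewrite tE nE; nia.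
      rewrite (Euclid_dvdzM (l := 2)) // orbb => h; exists (t' %/ 2)%Z; lia.
    exists (1 - n), (1 + k'); rewrite one_add_sqr tE k'E !(intrD, intrM); ring.
  (* The residue 6 modulo 9 means n' = 1 modulo 3, so 9 divides the coefficient of th in (1 +
     th)^3. *)
  have [q qE] : exists q, 1 + t + t' * t - n' = 3 * q.
    exists ((1 + t + t' * t - n') %/ 3)%Z; move: E; rewrite tE nE.
    move: (t' ^+ 2) => *; lia.
  exists (1 - 3 * n - t * n), q; rewrite one_add_cube.
  have -> : 3 + 3 * t + t ^+ 2 - n = 9 * q.
    transitivity (3 * (1 + t + t' * t - n')); first by rewrite tE nE; ring.
    by rewrite qE; ring.
  by rewrite !(intrD, intrM); ring.
exact: trivial_reduction.
Qed.

Lemma kappa_model_unramified_two d : l = 2%N -> ~~ (l %| t)%Z -> (1 < d)%N ->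
  @kappa_model K hK c l c_gt0 l_pr d
    (Zmod (l ^ (d - 2)) * Zmod l)%type (Zmod (l ^ (d - 1)) * Zmod l)%type
    (fun x => (@can_Zmod _ _ x.1, x.2)).
Proof.
move=> l2 lt d1.
have lev1 := at_level_one_add 1; have nil1 : nilp l t n 1 by left.
have lev2 := at_level_one_add 2; have nil2 : nilp l t n 2 by left.
apply: (kappa_model_split hK c_gt0 l_pr gen units _ _ d1 nil1 _ (at_level_coprime nil2 lev2) lev1
  (at_level_coprime nil1 lev1)) => //.
- by apply: (level_sequence_pow l_pr gen nil2) => // j; apply: (power_small_2 l_pr gen).
- case: gen => _ _ ->; rewrite l2 in lt *.
  (* (1 + 2 th)^2 = 1 - 4 n + 4 (1 + t) th with t odd, so it lies in O_3; for t = -1, 1 + 2 th is a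
     square root of the discriminant. *)
  exists (1 - 4 * n), ((1 + t) %/ 2)%Z; have [k tE] : exists k, t = 2 * k + 1.
    by exists (t %/ 2)%Z; lia.
  have -> : ((1 + t) %/ 2)%Z = k + 1 by rewrite tE; lia.
  rewrite expn1; transitivity (1 + 4 * th + 4 * th ^+ 2); first by ring.
  by rewrite th2 tE !(intrD, intrM, intrN); ring.
by apply: (unramified_reduction l_pr gen); left.
Qed.

End Cases.

(** O_0 has discriminant c^2 D. Residues 8 and 12 modulo 16 make D even, so c^2 = 1 modulo 8 keeps
    them; likewise c^2 = 1 modulo 3 keeps the residues 3 and 6 modulo 9. *)
Lemma odd_sqr_mod8 (c : nat) : ~~ (2 %| c)%N -> exists e : int, c%:Z ^+ 2 = 8 * e + 1.
Proof.
rewrite dvdn2 negbK => codd; have cE : c%:Z = 2 * (c./2)%:Z + 1.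
  by have := odd_double_half c; rewrite codd; lia.
have [k [kE|kE]] : exists k, (c./2)%:Z = 2 * k \/ (c./2)%:Z = 2 * k + 1.
  by exists ((c./2)%:Z %/ 2)%Z; lia.
  by exists (2 * k ^+ 2 + k); rewrite cE kE; ring.
by exists (2 * k ^+ 2 + 3 * k + 1); rewrite cE kE; ring.
Qed.

Lemma sqr_mod3 (c : nat) : ~~ (3 %| c)%N -> exists e : int, c%:Z ^+ 2 = 3 * e + 1.
Proof.
move=> hc; have [k [kE|kE]] : exists k, c%:Z = 3 * k + 1 \/ c%:Z = 3 * k - 1.
  by exists ((c%:Z + 1) %/ 3)%Z; lia.
  by exists (3 * k ^+ 2 + 2 * k); rewrite kE; ring.
by exists (3 * k ^+ 2 - 2 * k); rewrite kE; ring.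
Qed.

Lemma modzD (D a m : int) : 0 <= a < m -> (D = a %[mod m])%Z ->
  exists k, D = m * k + a.
Proof.
by move=> ham h; exists (D %/ m)%Z; rewrite {1}(divz_eq D m) h modz_small // mulrC.
Qed.

Lemma mulz_neqN_small (m x D : int) : 0 < m < x -> x * D <> - m.
Proof.
move=> /andP[m0 mx] h; have x0 : 0 <= x by rewrite ltW // (lt_trans m0).
have [D0|D0] := leP 0 D; first by have := mulr_ge0 x0 D0; rewrite h; lia.
have : x * D <= x * - 1 by rewrite ler_wpM2l //; lia.
by rewrite h; lia.
Qed.

Lemma sqr_mul_eqm3 (c : nat) (D : int) : c%:Z ^+ 2 * D = - 3 -> c = 1%N /\ D = - 3.
Proof.
case: c => [|[|c]]; [by rewrite mul0r|by rewrite expr1n mul1r|].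
by move=> /mulz_neqN_small[]; apply/andP; split=> //; nia.
Qed.

(** An odd c > 1 has c^2 >= 9, whereas c = 2 would leave D = -1. *)
Lemma sqr_mul_eqm4 (c : nat) (D : int) : ~~ (2 %| c)%N -> c%:Z ^+ 2 * D = - 4 ->
  c = 1%N /\ D = - 4.
Proof.
case: c => [|[|[|c]]] //; first by rewrite expr1n mul1r.
by move=> _ /mulz_neqN_small[]; apply/andP; split=> //; nia.
Qed.

(** For c = 1, the values -4 and -3 of D meet the conditions of (c) with l = 2 and l = 3, and there
    the extra units of O_0 bring the order of kappa_d down from l^d to l^(d - 1); hence the
    exclusion in (c). *)
Theorem theorem3p1 (K : fieldExtType rat) (hK : quadratic K) (imK : imaginary K)
    (D : int) (hD : is_discriminant K D) (l c : nat) (l_pr : prime l)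
    (c_gt0 : (0 < c)%N) (l_c : ~~ (l %| c)%N) :
  let kappa := kappa hK c_gt0 l_pr in
  let pi := pi_ hK c_gt0 l_pr in
  let model d := @kappa_model K hK c l c_gt0 l_pr d in
  let unramified := split_in K l \/ inert_in K l in
  (kappa 0%N = [set 0] /\ forall C, kappa 1%N C -> pi 0%N C = 0) /\
  (* (a) *)
  (forall d : nat, (1 <= d)%N -> (3 <= l)%N -> unramified ->
    model d (Zmod (l ^ (d - 1))) (Zmod (l ^ d)) (can_Zmod _)) /\
  (* (b) *)
  (forall d : nat, (1 <= d)%N -> ramified_in K l ->
    (l = 2%N /\ (D = 8 %[mod 16])%Z) \/ (l = 3%N /\ (D = 3 %[mod 9])%Z) \/
      (5 <= l)%N ->
    model d (Zmod (l ^ d)) (Zmod (l ^ d.+1)) (can_Zmod _)) /\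
  (* (c) *)
  (forall d : nat, (1 <= d)%N -> ramified_in K l ->
    (l = 2%N /\ (D = 12 %[mod 16])%Z) \/ (l = 3%N /\ (D = 6 %[mod 9])%Z) ->
    ~ (c = 1%N /\ (D = -3 \/ D = -4)) ->
    model d (Zmod (l ^ (d - 1)) * Zmod l)%type (Zmod (l ^ d) * Zmod l)%type
      (fun x => (can_Zmod _ x.1, x.2))) /\
  (* (d) *)
  (forall d : nat, (2 <= d)%N -> l = 2%N -> unramified ->
    model d (Zmod (2 ^ (d - 2)) * Zmod 2)%type (Zmod (2 ^ (d - 1)) * Zmod 2)%type
      (fun x => (can_Zmod _ x.1, x.2))) /\
  (l = 2%N -> unramified -> kappa 1%N = [set 0]).
Proof.
move=> kap pi model unram.
have [w [t0 [n0 [gen0 DE]]]] := discriminant_generates hK hD.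
have D0 := imaginary_disc hK imK gen0; rewrite -DE in D0.
have [th [t [n [gen EE hram hunr]]]] := generates_normal l_pr (generates_conductor c_gt0 gen0).
have E : t ^+ 2 - 4 * n = c%:Z ^+ 2 * D by rewrite EE DE; ring.
have lED : (l %| t ^+ 2 - 4 * n)%Z = (l %| D)%Z.
  by rewrite E Euclid_dvdzM // expr2 Euclid_dvdzM // orbb dvdzE (negbTE l_c).
rewrite -EE lED in hram hunr; rewrite E in lED.
have ramP : ramified_in K l -> nilp l t n 0.
  by move=> /(ramified_dvd l_pr gen0); rewrite -DE => /hram; right.
have unrP : unram -> ~~ (l %| D)%Z.
  by move=> /(unramified_ndvd l_pr gen0); rewrite -DE.
have units : (c%:Z ^+ 2 * D = -3 -> l <> 3%N) -> (c%:Z ^+ 2 * D = -4 -> l <> 2%N) ->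
    units_prime_to K c l.
  rewrite -E => h3 h4; apply: (units_of_disc l_pr gen) => //.
  by rewrite E pmulr_rlt0 // exprn_gt0 // ltz_nat.
have units_unr : unram -> units_prime_to K c l.
  move=> /unrP lD; apply: units => h lE; move: lD; rewrite -lED h lE //.
have red : unram -> forall al : K, coprime_elt c l al ->
    exists q, coprime l q /\ qorder (c * l ^ 1) (al ^+ q).
  by move=> hu; apply: (unramified_reduction l_pr gen (hunr (unrP hu))).
have c2 : l = 2%N -> exists e : int, c%:Z ^+ 2 = 8 * e + 1.
  by move=> l2; apply: odd_sqr_mod8; rewrite -l2.
have c3 : l = 3%N -> exists e : int, c%:Z ^+ 2 = 3 * e + 1.
  by move=> l3; apply: sqr_mod3; rewrite -l3.
split; [split|split; [|split; [|split; [|split]]]].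
- exact: kappa0.
- move=> C [_ h]; rewrite -[LHS](Cl_map0_id _ (leq0n 0)).
  by rewrite Cl_map_pi.
- move=> d d1 l3 hu; have [[l2 _]|[lodd lt ln]] := hunr (unrP hu).
    by rewrite l2 in l3.
  exact: (kappa_model_unramified_odd hK c_gt0 l_pr gen (units_unr hu)).
- move=> d d1 /ramP nil0 hl.
  have {}hl : [\/ l = 2%N /\ exists k, t ^+ 2 - 4 * n = 16 * k + 8,
      l = 3%N /\ exists k, t ^+ 2 - 4 * n = 9 * k + 3 | (5 <= l)%N].
    rewrite E; case: hl => [[l2 /(@modzD D 8 16)[//|k ->]]|[[l3 /(@modzD D 3 9)[//|k ->]]|l5]].
    + apply: Or31; split=> //; have [e ->] := c2 l2.
      by exists (8 * e * k + k + 4 * e); ring.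
    + apply: Or32; split=> //; have [e ->] := c3 l3.
      by exists (3 * e * k + k + e); ring.
    + exact: Or33.
  apply: (kappa_model_ramified_cyclic hK c_gt0 l_pr gen) => //.
  (* -4 is 12 modulo 16 and -3 is 6 modulo 9, so the residues of (b) avoid both. *)
  by apply: units; rewrite -E => h lE; move: h;
    (case: hl => [[_ [k ->]]|[_ [k ->]]|l5]; last by rewrite lE in l5); clear; lia.
- move=> d d1 /ramP nil0 hl hex; apply: (kappa_model_ramified_split hK c_gt0 l_pr gen) => //.
    apply: units => [/sqr_mul_eqm3[c1 D3] _|h l2].
      by apply: hex; split=> //; left.
    have [|c1 D4] := sqr_mul_eqm4 _ h; first by rewrite -l2.
    by apply: hex; split=> //; right.
  rewrite E; case: hl => -[l23 hD']; [left|right]; split=> //.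
    have [//|k ->] := modzD _ hD'; have [e ->] := c2 l23.
    by exists (8 * e * k + k + 6 * e); ring.
  have [//|k ->] := modzD _ hD'; have [e ->] := c3 l23.
  by exists (3 * e * k + k + 2 * e); ring.
- move=> d d1 l2 hu.
  have lt : ~~ (l %| t)%Z by case: (hunr (unrP hu)) => [[]//|[]]; rewrite {1}l2.
  have := kappa_model_unramified_two hK c_gt0 l_pr gen (units_unr hu) l2 lt d1.
  by rewrite /model; subst l.
- by move=> l2 hu; apply: (kappa1_eq0 hK c_gt0 l_pr gen); apply: red.
Qed.
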